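(* Let $\mathcal{T}$ be a self-affine tiling of $\mathbb{R}^d$ generated by a primitive substitution rule $\omega$ with finite local complexity and expansion map $Q=nI$, where $n$ is a positive integer, and let $\Xi$ be the set of return vectors of $\mathcal{T}$. Then there are a lattice $L$ of $\mathbb{R}^d$ and a positive integer $M$ such that $L\subset\underbrace{\Xi+\Xi+\cdots+\Xi}_{M\text{ times}}$. If moreover $\mathcal{T}$ has pure discrete dynamical spectrum, then there are also a positive integer $K$ and a tile $T\in\mathcal{T}$ such that $\{T+x: x\in n^KL\}\subset\mathcal{T}$.
   Context: A tile in $\mathbb{R}^d$ is a compact set equal to the closure of its interior, possibly labeled from a finite set. Patches: sets of tiles with pairwise disjoint interiors; tilings: patches with support $\mathbb{R}^d$. $\mathcal{P}\sqcap S=\{T\in\mathcal{P}:\operatorname{supp}T\cap S\neq\emptyset\}$. Substitution rule: finite prototile set $\mathcal{A}$, linear $Q$ with all eigenvalues of modulus $>1$, map $\omega$ sending $P\in\mathcal{A}$ to a finite patch of translates of prototiles with $\operatorname{supp}\omega(P)=Q(\operatorname{supp}P)$, extended by $\omega(P+x)=\omega(P)+Qx$ and unions; primitive if some power of the substitution matrix is positive; FLC if $\{\omega^n(P)\sqcap(K+x)\}_{n>0,P,x}$ is finite up to translation for each compact $K$. A self-affine tiling for $\omega$ is a tiling $\mathcal{T}$ of translates of prototiles with $\omega(\mathcal{T})=\mathcal{T}$, having finite local complexity and being repetitive. A return vector is $x$ with $T,T+x\in\mathcal{T}$ for some tile $T$. Pure discrete dynamical spectrum: $L^2(\mu)$,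 $\mu$ the unique translation-invariant probability measure on the hull $X_{\mathcal{T}}$ (closure of $\{\mathcal{T}+x\}$ in the local matching topology), has an orthonormal basis of eigenfunctions $f$, i.e. $f(\mathcal{S}-x)=e^{2\pi i\langle x,a\rangle}f(\mathcal{S})$ a.e. for all $x$, for some $a$. *)

(* Defs.v *)
From HB Require Import structures.
From mathcomp Require Import all_boot all_algebra.
From mathcomp Require Import all_classical all_reals all_analysis.
From mathcomp Require Export complex.
Set Implicit Arguments. Unset Strict Implicit. Unset Printing Implicit Defensive.
Import GRing.Theory Num.Theory numFieldNormedType.Exports.
Local Open Scope classical_set_scope.
Local Open Scope ring_scope.

Section Tilings.
Variables (R : realType) (d : nat) (Lab : finType).

Local Notation vec := 'rV[R]_d.

Definition tile := (set vec * Lab)%type.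

Definition is_tile (T : tile) : Prop :=
  compact T.1 /\ T.1 = closure (interior T.1) /\ T.1 !=set0.

Definition shift (S : set vec) (x : vec) : set vec := [set y + x | y in S].

Definition tr (T : tile) (x : vec) : tile := (shift T.1 x, T.2).
Definition ptr (P : set tile) (x : vec) : set tile := [set tr T x | T in P].

Definition is_patch (P : set tile) : Prop :=
  (forall T, P T -> is_tile T) /\
  (forall T T', P T -> P T' -> T <> T' -> interior T.1 `&` interior T'.1 = set0).

Definition is_tiling (P : set tile) : Prop :=
  is_patch P /\ \bigcup_(T in P) T.1 = setT.

Definition sqcap (P : set tile) (S : set vec) : set tile :=
  [set T | P T /\ T.1 `&` S !=set0].

Definition fin_up_to_tr (C : set (set tile)) : Prop :=
  exists (N : nat) (F : nat -> set tile),
    forall P, C P -> exists j, (j < N)%N /\ exists y, P = ptr (F j) y.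

Section Subst.
Variables (I : finType) (proto : I -> tile) (Q : 'M[R]_d)
          (omega : I -> seq (I * vec)).
(* The prototile set is {proto i | i : I}; Q acts on row vectors by x |-> x *m Q;
   omega i lists the (type, translation) pairs of the tiles of omega(proto i). *)

Definition omega_patch (i : I) : set tile :=
  [set T | exists2 p, p \in omega i & T = tr (proto p.1) p.2].

(* omega extended by omega(P + x) = omega(P) + Qx *)
Definition subst_tile (T : tile) : set tile :=
  [set T' | exists i x, T = tr (proto i) x /\
            exists2 p, p \in omega i & T' = tr (proto p.1) (p.2 + x *m Q)].

Definition subst (P : set tile) : set tile := \bigcup_(T in P) subst_tile T.

Definition expanding (Q0 : 'M[R]_d) : Prop :=
  forall (l : R[i]) (v : 'rV[R[i]]_d), v != 0 ->
    v *m map_mx (fun r : R => (r%:C)%C) Q0 = l *: v -> 1 < `|l|.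

Definition subst_rule : Prop :=
  (forall i, is_tile (proto i)) /\
  (forall i j x, proto i = tr (proto j) x -> i = j) /\
  expanding Q /\
  (forall i, uniq (omega i)) /\
  (forall i, is_patch (omega_patch i)) /\
  (forall i, \bigcup_(T in omega_patch i) T.1 = [set y *m Q | y in (proto i).1]).

Definition subst_matrix : 'M[int]_#|I| :=
  \matrix_(a, b) (count (fun p => p.1 == enum_val a) (omega (enum_val b)))%:Z.

Definition primitive : Prop :=
  exists k, (0 < k)%N /\ forall a b, 0 < (subst_matrix ^+ k) a b.

Definition rule_FLC : Prop :=
  forall K : set vec, compact K ->
    fin_up_to_tr [set P | exists m i x, (0 < m)%N /\
                     P = sqcap (iter m subst [set proto i]) (shift K x)].

Definition tiling_FLC (Tl : set tile) : Prop :=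
  forall K : set vec, compact K ->
    fin_up_to_tr [set P | exists x, P = sqcap Tl (shift K x)].

Definition repetitive (Tl : set tile) : Prop :=
  forall K : set vec, compact K -> exists F : set vec, compact F /\
    forall x y, exists z, F z /\
      sqcap Tl (shift K x) = ptr (sqcap Tl (shift K (y + z))) (x - (y + z)).

Definition self_affine (Tl : set tile) : Prop :=
  is_tiling Tl /\
  (forall T, Tl T -> exists i x, T = tr (proto i) x) /\
  subst Tl = Tl /\ tiling_FLC Tl /\ repetitive Tl.

End Subst.

Definition return_vectors (Tl : set tile) : set vec :=
  [set x | exists T, Tl T /\ Tl (tr T x)].

Definition sumset (A B : set vec) : set vec := [set a + b | a in A & b in B].

(* A + A + ... + A  (M times), M >= 1 *)
Definition sumset_iter (A : set vec) (M : nat) : set vec := iter M.-1 (sumset A) A.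

Definition lattice (L : set vec) : Prop :=
  exists B : 'M[R]_d, B \in unitmx /\
    L = [set map_mx (fun z : int => z%:~R) z *m B | z in [set: 'rV[int]_d]].

Definition agree (S S' : set tile) (r eps : R) : Prop :=
  exists x y : vec, `|x| < eps /\ `|y| < eps /\
    sqcap (ptr S x) (ball (0 : vec) r) = sqcap (ptr S' y) (ball (0 : vec) r).

Definition lm_open (U : set (set tile)) : Prop :=
  forall S, U S -> exists r eps : R, 0 < r /\ 0 < eps /\
    [set S' | agree S S' r eps] `<=` U.

(* closure of the orbit {Tl + x} in the local matching topology *)
Definition hull (Tl : set tile) : set (set tile) :=
  [set S | forall r eps : R, 0 < r -> 0 < eps -> exists x, agree S (ptr Tl x) r eps].

Definition hull_open (Tl : set tile) : set (set (set tile)) :=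
  [set U `&` hull Tl | U in lm_open].

End Tilings.

Notation hull_space Tl := (g_sigma_algebraType (hull_open Tl)).

Section Spectrum.
Variables (R : realType) (d : nat) (Lab : finType).
Local Notation vec := 'rV[R]_d.
Local Notation Til := (set (tile R d Lab)).
Variable (Tl : Til).
Variable (mu : probability (hull_space Tl) R).

Definition sqn (z : R[i]) : R := (complex.Re z) ^+ 2 + (complex.Im z) ^+ 2.

Definition L2 (f : hull_space Tl -> R[i]) : Prop :=
  measurable_fun setT (fun S => complex.Re (f S)) /\
  measurable_fun setT (fun S => complex.Im (f S)) /\
  (\int[mu]_S (sqn (f S))%:E < +oo)%E.

Definition expi (t : R) : R[i] := ((cos t) +i* (sin t))%C.

Definition dotv (x a : vec) : R := (x *m a^T) ord0 ord0.

Definition eigenfunction (f : hull_space Tl -> R[i]) : Prop :=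
  exists a : vec, forall x : vec,
    {ae mu, forall S, f (ptr S (- x)) = expi (2 * pi * dotv x a) * f S}.

Definition inner_zero (f g : hull_space Tl -> R[i]) : Prop :=
  (\int[mu]_S (complex.Re (f S * conjc (g S)))%:E = 0)%E /\
  (\int[mu]_S (complex.Im (f S * conjc (g S)))%:E = 0)%E.

Definition translation_invariant_prob : Prop :=
  mu (hull Tl) = 1%E /\
  forall (x : vec) (A : set (hull_space Tl)), measurable A ->
    mu ((fun S => ptr S x) @^-1` A) = mu A.

Definition pure_discrete_spectrum : Prop :=
  translation_invariant_prob /\
  exists E : set (hull_space Tl -> R[i]),
    (forall f, E f -> L2 f /\ eigenfunction f /\ (\int[mu]_S (sqn (f S))%:E = 1)%E) /\
    (forall f g, E f -> E g -> f <> g -> inner_zero f g) /\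
    (forall g, L2 g -> forall eps : R, 0 < eps ->
       exists (k : nat) (c : 'I_k -> R[i]) (f : 'I_k -> hull_space Tl -> R[i]),
         (forall j, E (f j)) /\
         (\int[mu]_S (sqn (g S - \sum_(j < k) c j * f j S))%:E < eps%:E)%E).

End Spectrum.

(* Main.v *)
(* Let D be the set of differences of positions of the tiles of a fixed type, recentred so that the
   positions form a set C with N C ⊂ C for a power N of n.  An additive function g on the group
   generated by D is Lipschitz on C.  Take a long segment between points of C whose g-slope is almost
   the supremum: around its midpoint g is almost linear (a Lipschitz function attaining its maximal
   slope along a segment is differentiable inside it), and by repetitivity every finite part of D is
   realised there.  So g respects all real linear relations in D; hence these are spanned by integer
   relations, and D lies in a lattice.  By relative density of C, the lattice spanned by a basis
   chosen in D then lies in a finite iterated sum of D.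

   If f is an eigenfunction with eigenvalue a and x ∈ D, then large supertiles recur at distance
   n^k x, while f is nearly determined by a finite window up to a set of small measure; so
   exp(2πi n^k <x, a>) tends to 1.  With an orthonormal basis of eigenfunctions, the tilings with a
   tile of the fixed type near 0 but none near n^k x therefore have measure tending to 0, for every x
   in the lattice L.  If no two tiles at distance n^k x both lay in the relevant part of n^k U, for a
   ball U, then a number of translates of this exceptional set that does not depend on k would cover
   the hull; so for some k two tiles of the tiling at distance n^k x lie over n^k U.  Such
   coincidences merge one by one the finitely many tiles of Tl + L that meet a given ball,
   shrinking the ball at each step: all of them end up having a common tile T in their K-th
   supertiles, and T + n^K L ⊂ Tl. *)

Require Import Defs.
From HB Require Import structures.
From mathcomp Require Import all_boot all_order all_algebra.
From mathcomp Require Import all_classical all_reals all_analysis.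
From mathcomp Require Import complex.
From mathcomp Require Import measurable_realfun ring lra.
Import Order.TTheory GRing.Theory Num.Theory numFieldNormedType.Exports.
Local Open Scope classical_set_scope.
Local Open Scope ring_scope.
Set Implicit Arguments. Unset Strict Implicit. Unset Printing Implicit Defensive.

Local Notation intmx := (map_mx (fun z : int => z%:~R)).

(** * Rational relations between vectors *)

(** Among all integer matrices of relations, one of maximal real rank is chosen: appending a further
    relation [z] cannot raise the rank, so [z] already lies in the real row space. *)
Lemma integer_relation_basis (R : realType) (N d : nat) (V : 'M[R]_(N, d)) :
  exists (m : nat) (K : 'M[int]_(m, N)),
    (intmx K : 'M[R]_(m, N)) *m V = 0 /\
    forall z : 'rV[int]_N, (intmx z : 'rV[R]_N) *m V = 0 ->
      ((intmx z : 'rV[R]_N) <= (intmx K : 'M[R]_(m, N)))%MS.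
Proof.
pose P r := `[< exists (m : nat) (K : 'M[int]_(m, N)),
  (intmx K : 'M[R]_(m, N)) *m V = 0 /\ \rank (intmx K : 'M[R]_(m, N)) = r >].
have exP : exists r, P r.
  by exists (\rank (intmx (0 : 'M[int]_(0, N)) : 'M[R]_(0, N))); apply/asboolP;
    exists 0%N, 0; split => //; apply/matrixP => -[].
have boundP r : P r -> (r <= N)%N.
  by move=> /asboolP[m [K [_ <-]]]; exact: rank_leq_col.
case: (ex_maxnP exP boundP) => r /asboolP[m [K [KV rK]]] rmax.
exists m, K; split => // z zV.
have /rmax : P (\rank (intmx (col_mx K z) : 'M[R]_(m + 1, N))).
  apply/asboolP; exists (m + 1)%N, (col_mx K z); split => //.
  by rewrite map_col_mx mul_col_mx KV zV col_mx0.
rewrite map_col_mx -addsmxE -rK => le.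
have sub : ((intmx K : 'M[R]_(m, N)) <= (intmx K : 'M[R]_(m, N)) + (intmx z : 'rV[R]_N))%MS by exact: addsmxSl.
have := mxrank_leqif_sup sub.
move=> [_ /esym]; rewrite eqn_leq le mxrankS //= => sup.
exact: submx_trans (addsmxSr _ _) sup.
Qed.

Lemma rat_to_int_mx (m n : nat) (A : 'M[rat]_(m, n)) :
  exists (D : int) (A' : 'M[int]_(m, n)), D != 0 /\ intmx A' = D%:~R *: A.
Proof.
pose D := \prod_i \prod_j denq (A i j).
have Dn0 : D != 0 by apply/prodf_neq0 => i _; apply/prodf_neq0 => j _; rewrite denq_neq0.
have Dk i j : exists k : int, D = k * denq (A i j).
  exists ((\prod_(i' | i' != i) \prod_j denq (A i' j)) * \prod_(j' | j' != j) denq (A i j')).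
  by rewrite /D (bigD1 i) //= (bigD1 j) //=; ring.
pose k i j := projT1 (cid (Dk i j)).
exists D, (\matrix_(i, j) (k i j * numq (A i j))); split => //.
apply/matrixP => i j; rewrite !mxE.
rewrite [in RHS](projT2 (cid (Dk i j))) -/(k i j) !intrM -mulrA; congr (_ * _).
by rewrite mulrC -numqE.
Qed.

(** The second hypothesis forces the left kernel of [V] to be spanned by integer relations. Its
    orthogonal complement, which contains the columns of [V], then has a rational basis, of [d]
    elements by a rank count; after clearing denominators these are the columns of [A]. *)
Lemma rational_row_space (R : realType) (N d : nat) (V : 'M[R]_(N, d)) :
  row_full V ->
  (forall g : 'cV[R]_N,
     (forall z : 'rV[int]_N, (intmx z : 'rV[R]_N) *m V = 0 -> (intmx z : 'rV[R]_N) *m g = 0) ->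
     forall r : 'rV[R]_N, r *m V = 0 -> r *m g = 0) ->
  exists (A : 'M[int]_(N, d)) (B : 'M[R]_d), B \in unitmx /\ V = intmx A *m B.
Proof.
move=> Vfull Vlin; have [m [K [KV Kmax]]] := integer_relation_basis V.
set KR : 'M[R]_(m, N) := intmx K in KV Kmax.
(* The columns of the cokernel of [KR] vanish on every integer relation; as test vectors [g] they
   show that each real relation lies in the row space of [KR]. *)
have kerK : (kermx V <= KR)%MS.
  rewrite submxE; apply/eqP/matrixP => i j.
  have rel (z : 'rV[int]_N) : (intmx z : 'rV[R]_N) *m V = 0 ->
      (intmx z : 'rV[R]_N) *m col j (cokermx KR) = 0.
    by move=> /Kmax; rewrite submxE => /eqP zK; rewrite colE mulmxA zK mul0mx.
  have := Vlin _ rel (row i (kermx V)); rewrite -row_mul mulmx_ker row0 => /(_ erefl).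
  by rewrite -row_mul colE mulmxA -colE => /matrixP /(_ 0 0); rewrite !mxE.
pose KQ : 'M[rat]_(m, N) := intmx K.
have KRQ : KR = map_mx ratr KQ.
  by apply/matrixP => i j; rewrite !mxE ratr_int.
have VT : (V^T <= kermx KR^T)%MS.
  by apply/sub_kermxP; rewrite -trmx_mul KV trmx0.
have rkerK : \rank (kermx KQ^T) = d.
  have := mxrank_ker V; rewrite (eqP Vfull) => rkV.
  have dN : (d <= N)%N by rewrite -(eqP Vfull) rank_leq_row.
  have : \rank KR = (N - d)%N.
    apply/eqP; rewrite eqn_leq -{2}rkV mxrankS // andbT -rkV mxrankS //.
    by apply/sub_kermxP.
  by rewrite KRQ mxrank_map mxrank_ker mxrank_tr => ->; rewrite subKn.
have [AQ AQK] : exists AQ : 'M[rat]_(d, N), (AQ == kermx KQ^T)%MS.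
  by move: (row_base (kermx KQ^T)) (eq_row_base (kermx KQ^T));
    rewrite rkerK => AQ /eqmxP; exists AQ.
have [D [A [Dn0 AD]]] := rat_to_int_mx AQ^T.
have : (V^T <= (intmx A : 'M[R]_(N, d))^T)%MS.
  have -> : (intmx A : 'M[R]_(N, d))^T = D%:~R *: map_mx ratr AQ.
    apply/matrixP => i j; have /matrixP/(_ j i) := AD.
    by rewrite !mxE => /(congr1 (fun q : rat => ratr q : R)); rewrite rmorphM /= !ratr_int.
  apply: (submx_trans VT); rewrite eqmx_scale ?intr_eq0 //.
  rewrite KRQ map_trmx -map_kermx map_submx.
  by case/andP: AQK.
move=> /submxP[X VX]; exists A, X^T.
have VE : V = intmx A *m X^T by apply: trmx_inj; rewrite trmx_mul trmxK.
split => //; rewrite unitmx_tr -row_free_unit -row_leq_rank -{1}(eqP Vfull) -mxrank_tr VX.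
exact: mxrankM_maxl.
Qed.

(** * Homogeneous Lipschitz functions of maximal slope *)

Section Dot.
Variables (R : realType) (d : nat).
Implicit Types x y a : 'rV[R]_d.

Lemma dotvE x a : dotv x a = \sum_i x 0 i * a 0 i.
Proof. by rewrite /dotv mxE; apply: eq_bigr => i _; rewrite mxE. Qed.

Lemma dotvDl x y a : dotv (x + y) a = dotv x a + dotv y a.
Proof. by rewrite /dotv mulmxDl mxE. Qed.

Lemma dotvZl (c : R) x a : dotv (c *: x) a = c * dotv x a.
Proof. by rewrite /dotv -scalemxAl mxE. Qed.

Lemma dotvC x a : dotv x a = dotv a x.
Proof. by rewrite !dotvE; apply: eq_bigr => i _; rewrite mulrC. Qed.

Lemma dotvNl x a : dotv (- x) a = - dotv x a.
Proof. by rewrite -scaleN1r dotvZl mulN1r. Qed.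

Lemma dotvBl x y a : dotv (x - y) a = dotv x a - dotv y a.
Proof. by rewrite dotvDl dotvNl. Qed.

Lemma dotv0l a : dotv 0 a = 0.
Proof. by rewrite -(scale0r 0) dotvZl mul0r. Qed.

Lemma dotvDr x y a : dotv a (x + y) = dotv a x + dotv a y.
Proof. by rewrite !(dotvC a) dotvDl. Qed.

Lemma dotvZr (c : R) x a : dotv a (c *: x) = c * dotv a x.
Proof. by rewrite !(dotvC a) dotvZl. Qed.

Lemma dotv_ge0 x : 0 <= dotv x x.
Proof. by rewrite dotvE sumr_ge0 // => i _; rewrite -expr2 sqr_ge0. Qed.

Lemma coord_le_norm x i : `|x 0 i| <= `|x|.
Proof.
rewrite [leRHS]/Num.norm/= mx_normrE.
exact: (le_bigmax _ (fun ij : 'I_1 * 'I_d => `|x ij.1 ij.2|) (0, i)).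
Qed.

Lemma norm_le_coord x (c : R) : 0 <= c -> (forall i, `|x 0 i| <= c) -> `|x| <= c.
Proof.
move=> c0 xc; rewrite [leLHS]/Num.norm/= mx_normrE.
by apply: bigmax_le => // -[i j] _ /=; rewrite ord1.
Qed.

(** Norms of row vectors are maximum norms, whereas the extremal argument needs the Euclidean
    length; this and the next lemma compare the two. *)
Lemma norm_sqr_le_dotv x : `|x| ^+ 2 <= dotv x x.
Proof.
rewrite -[leRHS]sqr_sqrtr ?dotv_ge0 // ler_sqr ?nnegrE ?sqrtr_ge0 //.
apply: norm_le_coord => [|i]; first exact: sqrtr_ge0.
rewrite -sqrtr_sqr ler_wsqrtr // dotvE (bigD1 i) //= expr2 lerDl.
by apply: sumr_ge0 => j _; rewrite -expr2 sqr_ge0.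
Qed.

Lemma dotv_le_norm_sqr x : dotv x x <= d%:R * `|x| ^+ 2.
Proof.
have -> : d%:R * `|x| ^+ 2 = \sum_(i < d) `|x| ^+ 2 by rewrite sumr_const card_ord mulr_natl.
rewrite dotvE; apply: ler_sum => i _; rewrite -expr2 -real_normK ?num_real //.
by rewrite ler_sqr ?nnegrE // coord_le_norm.
Qed.

End Dot.

(** The tangent to the square root at s^2 / 4; it linearises Euclidean lengths close to s / 2. *)
Lemma sqrt_amgm (R : realType) (q s : R) : 0 < s -> 0 <= q ->
  Num.sqrt q <= q / s + s / 4.
Proof.
move=> s0 q0; set t := Num.sqrt q; have -> : q = t ^+ 2 by rewrite sqr_sqrtr.
rewrite -subr_ge0; have -> : t ^+ 2 / s + s / 4 - t = (t - s / 2) ^+ 2 / s.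
  by field; lra.
by rewrite divr_ge0 ?sqr_ge0 // ltW.
Qed.

Lemma expn_unbounded (R : realType) (q : nat) (x : R) : (1 < q)%N ->
  exists k0, forall k, (k0 <= k)%N -> x < (q%:R ^+ k).
Proof.
move=> q1; exists (Num.truncn `|x|).+1 => k k0.
apply: (le_lt_trans (ler_norm x)).
apply: (lt_le_trans (truncnS_gt `|x|)).
by rewrite -natrX ler_nat (leq_trans k0) // ltnW // ltn_expl.
Qed.

Section Extremal.
Variables (R : realType) (d q : nat) (C : set 'rV[R]_d) (F : 'rV[R]_d -> 'rV[R]_d -> R) (M : R).
Hypotheses (q1 : (1 < q)%N) (Cq : forall c, C c -> C (q%:R *: c)).
Hypothesis FD : forall a b c, C a -> C b -> C c -> F a c = F a b + F b c.
Hypothesis FZ : forall a b, C a -> C b -> F (q%:R *: a) (q%:R *: b) = q%:R * F a b.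
Hypothesis FM : forall a b, C a -> C b -> `|F a b| <= M * (`|b - a| + 1).

Let q0 : 0 < q%:R :> R. Proof. by rewrite ltr0n ltnW. Qed.
Let qk0 k : 0 < q%:R ^+ k :> R. Proof. exact: exprn_gt0. Qed.

Lemma iter_scale_mem k c : C c -> C (q%:R ^+ k *: c).
Proof.
elim: k => [|k IH] Cc; first by rewrite expr0 scale1r.
by rewrite exprS -scalerA; apply/Cq/IH.
Qed.

Lemma iter_scale_homog k a b : C a -> C b ->
  F (q%:R ^+ k *: a) (q%:R ^+ k *: b) = q%:R ^+ k * F a b.
Proof.
elim: k => [|k IH] Ca Cb; first by rewrite expr0 !scale1r mul1r.
by rewrite exprS -!scalerA FZ ?IH ?mulrA //; exact: iter_scale_mem.
Qed.

(* The additive error in FM disappears by homogeneity. *)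
Lemma homog_lipschitz a b : C a -> C b -> `|F a b| <= M * `|b - a|.
Proof.
move=> Ca Cb; rewrite leNgt; apply/negP => lt.
have [k0 /(_ k0 (leqnn _)) Mk] := expn_unbounded (M / (`|F a b| - M * `|b - a|)) q1.
have := FM (iter_scale_mem k0 Ca) (iter_scale_mem k0 Cb).
rewrite iter_scale_homog // -scalerBr normrM normrZ gtr0_norm // leNgt => /negP; apply.
have t0 : 0 < `|F a b| - M * `|b - a| by rewrite subr_gt0.
by move: Mk; rewrite ltr_pdivrMr //; lra.
Qed.

Let len (v : 'rV[R]_d) := Num.sqrt (dotv v v).

Let lenZ (t : R) v : 0 <= t -> len (t *: v) = t * len v.
Proof.
by move=> t0; rewrite /len dotvZl dotvZr mulrA -expr2 sqrtrM ?sqr_ge0 // sqrtr_sqr ger0_norm.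
Qed.

Let norm_le_len v : `|v| <= len v.
Proof.
by rewrite -[leLHS]ger0_norm // -sqrtr_sqr ler_wsqrtr // norm_sqr_le_dotv.
Qed.

Let len_gt0 v : v != 0 -> 0 < len v.
Proof. by move=> v0; apply: lt_le_trans (norm_le_len v); rewrite normr_gt0. Qed.

(** [F a b] plays the role of an increment g(b) - g(a), and [lam] is its largest slope for the
    Euclidean length. On a segment of slope almost [lam], both F(a, p) <= lam |p - a| and F(p, b) <=
    lam |b - p| are almost equalities for [p] close to the midpoint; there the lengths are linear in
    [p] up to an error of order r^2 / s, which squeezes [F] between two nearly equal affine
    functions. *)
Lemma extremal_slope_linear (r eps : R) : 0 < r -> 0 < eps ->
  exists m u : 'rV[R]_d, forall p p', C p -> C p' -> `|p - m| <= r -> `|p' - m| <= r ->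
    `|F p p' - dotv (p' - p) u| <= eps.
Proof.
move=> r0 eps0.
have Faa a : C a -> F a a = 0.
  by move=> Ca; have := FD Ca Ca Ca; rewrite -{1}[F a a]addr0 => /addrI <-.
have FN a b : C a -> C b -> F b a = - F a b.
  by move=> Ca Cb; have := FD Ca Cb Ca; rewrite Faa // => /esym/eqP; rewrite addrC addr_eq0 => /eqP.
have [F0|/existsNP[a0 /existsNP[b0 /not_implyP[Ca0 /not_implyP[Cb0 /eqP F0]]]]] :=
    pselect (forall a b, C a -> C b -> F a b = 0).
  by exists 0, 0 => p p' Cp Cp' _ _; rewrite F0 // dotvC dotv0l subr0 normr0 ltW.
have ab0 a b : C a -> C b -> F a b != 0 -> b - a != 0.
  by move=> Ca Cb; apply: contraNneq => /subr0_eq ->; rewrite Faa.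
pose E := [set t | exists a b, [/\ C a, C b, b - a != 0 & t = F a b / len (b - a)]].
have supE : has_sup E.
  split; first by exists (F a0 b0 / len (b0 - a0)), a0, b0; split => //; exact: ab0.
  exists `|M| => _ [a [b [Ca Cb ba ->]]]; rewrite ler_pdivrMr ?len_gt0 //.
  apply: le_trans (ler_norm _) _; apply: le_trans (homog_lipschitz Ca Cb) _.
  by apply: le_trans (ler_wpM2r _ (ler_norm M)) _ => //; apply: ler_wpM2l.
pose lam := sup E.
have Flam a b : C a -> C b -> F a b <= lam * len (b - a).
  move=> Ca Cb; have [/eqP ba|ba] := boolP (b - a == 0).
    by rewrite ba (subr0_eq ba) Faa // /len dotv0l sqrtr0 mulr0.
  rewrite -ler_pdivrMr ?len_gt0 //; apply: (sup_upper_bound supE).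
  by exists a, b.
have lam0 : 0 <= lam.
  have := Flam _ _ Ca0 Cb0; have := Flam _ _ Cb0 Ca0; rewrite (FN a0 b0) //.
  have -> : len (a0 - b0) = len (b0 - a0).
    by rewrite -opprB /len dotvNl dotvC dotvNl opprK.
  by have := len_gt0 (ab0 _ _ Ca0 Cb0 F0); nra.
(* [S] makes the quadratic error 2 lam d r^2 / s at most eps / 2 for s >= S; then [e1] makes the
   slope defect e1 s at most eps / 2 for s <= q S. *)
pose S := 4 * lam * d%:R * r ^+ 2 / eps + 1.
have S0 : 0 < S.
  rewrite ltr_wpDl //; apply: divr_ge0; last exact: ltW.
  by rewrite !mulr_ge0 // ltW.
pose e1 := eps / (2 * q%:R * S).
have e10 : 0 < e1 by rewrite divr_gt0 // !mulr_gt0.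
have [_ [a [b [Ca Cb ba0 ->]]] lamlt] := sup_adherent e10 supE.
(* Multiplication by powers of [q] keeps the slope and lengthens the segment. *)
wlog DS : a b Ca Cb ba0 lamlt / S <= len (b - a).
  move=> wl; have [k /(_ k (leqnn _)) Sk] := expn_unbounded (S / len (b - a)) q1.
  apply: (wl (q%:R ^+ k *: a) (q%:R ^+ k *: b)); rewrite -?scalerBr.
  - exact: iter_scale_mem.
  - exact: iter_scale_mem.
  - by rewrite scaler_eq0 negb_or ba0 gt_eqF.
  - by rewrite iter_scale_homog // lenZ ?ltW // -mulf_div divff ?mul1r ?gt_eqF.
  - by rewrite lenZ ?ltW //; move: Sk; rewrite ltr_pdivrMr ?len_gt0 // => /ltW.
(* [C] is closed under multiplication by [q], not under division. So the segment is not shrunk: [p]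
   is enlarged to q^j p and the result divided by q^j, which amounts to a segment of length [s]
   between [S] and q S. *)
have [j [jD Dj]] : exists j, q%:R ^+ j * S <= len (b - a) /\ len (b - a) <= q%:R ^+ j.+1 * S.
  have ex : exists k, len (b - a) < q%:R ^+ k * S.
    have [k /(_ k (leqnn _)) Sk] := expn_unbounded (len (b - a) / S) q1.
    by exists k; rewrite -ltr_pdivrMr.
  case: (ex_minnP ex) => -[|j] lt jmin.
    by move: lt; rewrite expr0 mul1r ltNge DS.
  exists j; split; last exact: ltW.
  by rewrite leNgt; apply/negP => /jmin; rewrite ltnn.
pose Q : R := q%:R ^+ j.
have Q0 : 0 < Q := qk0 j.
pose s := len (b - a) / Q.
have s0 : 0 < s by rewrite divr_gt0 ?len_gt0.
have sS : S <= s by rewrite ler_pdivlMr // mulrC.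
have sqS : s <= q%:R * S by rewrite ler_pdivrMr // mulrAC -exprS.
have [e eE] : exists e, e = Q^-1 *: (b - a) by exists (Q^-1 *: (b - a)).
pose m := Q^-1 *: (2^-1 *: (a + b)).
have ee : dotv e e = s ^+ 2.
  by rewrite eE dotvZl dotvZr /s expr_div_n sqr_sqrtr ?dotv_ge0 //; field; rewrite gt_eqF.
exists m, ((lam / s) *: e).
have key p : C p -> `|p - m| <= r ->
    let X := F a (Q *: p) / Q - lam * s / 2 - dotv (p - m) ((lam / s) *: e) in
    - (lam * (d%:R * r ^+ 2) / s) - e1 * s <= X <= lam * (d%:R * r ^+ 2) / s.
  move=> Cp; have [w wE] : exists w, w = p - m by exists (p - m).
  rewrite -wE => pm /=.
  have CQp : C (Q *: p) by exact: iter_scale_mem.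
  have ww : dotv w w <= d%:R * r ^+ 2.
    apply: le_trans (dotv_le_norm_sqr _) _; apply: ler_wpM2l => //.
    by rewrite ler_sqr ?nnegrE // ltW.
  (* For t = 1 and t = -1 these vectors are p - a / Q and b / Q - p. *)
  have lenb (t : R) : t ^+ 2 = 1 ->
      len (2^-1 *: e + t *: w) <= s / 2 + t * dotv w e / s + dotv w w / s.
    move=> t1; apply: le_trans (sqrt_amgm s0 (dotv_ge0 _)) _.
    have -> : dotv (2^-1 *: e + t *: w) (2^-1 *: e + t *: w) =
        s ^+ 2 / 4 + t * dotv w e + dotv w w.
      rewrite !(dotvDl, dotvDr, dotvZl, dotvZr) ee (dotvC e w).
      transitivity (s ^+ 2 / 4 + t * dotv w e + t ^+ 2 * dotv w w); first by field.
      by rewrite t1 mul1r.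
    by rewrite le_eqVlt; apply/orP; left; apply/eqP; field; rewrite gt_eqF.
  have E1 : Q *: p - a = Q *: (2^-1 *: e + 1 *: w).
    rewrite wE /m eE scale1r; apply/rowP => i; rewrite !mxE.
    by field; rewrite gt_eqF.
  have E2 : b - Q *: p = Q *: (2^-1 *: e + (-1) *: w).
    rewrite wE /m eE; apply/rowP => i; rewrite !mxE.
    by field; rewrite gt_eqF.
  have := Flam _ _ Ca CQp; have := Flam _ _ CQp Cb.
  rewrite E1 E2 !(lenZ _ (ltW Q0)) => up lo.
  have lamlt' : (lam - e1) * (s * Q) < F a b.
    by move: lamlt; rewrite ltr_pdivlMr ?len_gt0 // /s divfK // gt_eqF.
  have Fab := FD Ca CQp Cb.
  have l1 := lenb 1 (expr1n _ _); have l2 := lenb (-1) (sqrr_sign _ 1).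
  have loQ : F a (Q *: p) / Q <= lam * (s / 2 + 1 * dotv w e / s + dotv w w / s).
    rewrite ler_pdivrMr //; apply: le_trans lo _.
    by rewrite mulrA mulrAC ler_wpM2r ?(ltW Q0) // ler_wpM2l.
  have upQ : (lam - e1) * s - lam * (s / 2 + (-1) * dotv w e / s + dotv w w / s)
      <= F a (Q *: p) / Q.
    rewrite ler_pdivlMr // mulrBl -mulrA.
    have : lam * (Q * len (2^-1 *: e + -1 *: w)) <=
        lam * (s / 2 + (-1) * dotv w e / s + dotv w w / s) * Q.
      by rewrite mulrA mulrAC ler_wpM2r ?(ltW Q0) // ler_wpM2l.
    by lra.
  have wwl : lam * (dotv w w / s) <= lam * (d%:R * r ^+ 2) / s.
    by rewrite -mulrA ler_wpM2l // ler_wpM2r // invr_ge0 ltW.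
  have -> : dotv w (lam / s *: e) = lam * (dotv w e / s).
    by rewrite dotvZr; field; rewrite gt_eqF.
  apply/andP; split; lra.
move=> p p' Cp Cp' pm p'm.
have := key p Cp pm; have := key p' Cp' p'm => /= /andP[k1 k2] /andP[k3 k4].
have CQp := iter_scale_mem j Cp; have CQp' := iter_scale_mem j Cp'.
have Fpp : F p p' = F a (Q *: p') / Q - F a (Q *: p) / Q.
  by rewrite (FD Ca CQp CQp') iter_scale_homog // -/Q; field; rewrite gt_eqF.
have -> : p' - p = (p' - m) - (p - m) by rewrite opprB addrA subrK.
rewrite (dotvBl (p' - m)) Fpp.
have b1 : e1 * s <= eps / 2.
  have -> : eps / 2 = e1 * (q%:R * S) by rewrite /e1; field; rewrite !gt_eqF.
  by rewrite ler_wpM2l // ltW.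
have b2 : 2 * (lam * (d%:R * r ^+ 2) / s) <= eps / 2.
  have : 4 * lam * d%:R * r ^+ 2 <= eps * s.
    have : 4 * lam * d%:R * r ^+ 2 <= eps * S.
      by rewrite /S mulrDr mulr1 [eps * _]mulrC divfK ?gt_eqF // lerDl ltW.
    by move=> /le_trans; apply; rewrite ler_wpM2l // ltW.
  rewrite mulrA ler_pdivrMr //; lra.
by rewrite ler_norml; apply/andP; split; lra.
Qed.

End Extremal.

(** * Lattices in iterated sums of difference sets *)

(** A grid of mesh delta / 2: the cell of a vector is the tuple of its rescaled and truncated
    coordinates. *)
Lemma small_cells (R : realType) (d : nat) (r delta : R) : 0 < delta ->
  exists (T : finType) (cell : 'rV[R]_d -> T),
    forall x y, `|x| <= r -> `|y| <= r -> cell x = cell y -> `|x - y| < delta.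
Proof.
move=> d0; pose h := delta / 2; have h0 : 0 < h by rewrite divr_gt0.
pose N := (Num.truncn ((r + r) / h)).+1.
exists {ffun 'I_d -> 'I_N.+1}, (fun x => [ffun i => inord (Num.truncn ((x 0 i + r) / h))]).
move=> x y xr yr /ffunP xy.
suff: `|x - y| <= h by move=> /le_lt_trans; apply; rewrite /h; lra.
apply: norm_le_coord => [|i]; first exact: ltW.
have ub (z : 'rV[R]_d) : `|z| <= r ->
    0 <= (z 0 i + r) / h /\ (Num.truncn ((z 0 i + r) / h)%R < N.+1)%N.
  move=> zr; have := le_trans (coord_le_norm z i) zr; rewrite ler_norml => /andP[z1 z2].
  have z0 : 0 <= (z 0 i + r) / h by rewrite divr_ge0 ?(ltW h0) // -lerBlDr sub0r.
  split => //; rewrite ltnS /N; apply: leqW; apply: le_truncn.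
  by rewrite ler_wpM2r ?invr_ge0 ?(ltW h0) // lerD2r.
have [x0 xN] := ub x xr; have [y0 yN] := ub y yr.
have := xy i; rewrite !ffunE => /(congr1 (@nat_of_ord _)); rewrite !inordK // => e.
have := truncn_itv x0; have := truncn_itv y0; rewrite e => /andP[a1 a2] /andP[b1 b2].
have : `|(x 0 i + r) / h - (y 0 i + r) / h| <= 1.
  rewrite ler_norml; move: a1 a2 b1 b2; rewrite -natr1.
  by set X := (x 0 i + r) / h; set Y := (y 0 i + r) / h; move=> *; apply/andP; split; lra.
rewrite -mulrBl normrM normfV (gtr0_norm h0) ler_pdivrMr // mul1r.
by rewrite !mxE opprD addrACA subrr addr0.
Qed.

(** Pigeonhole: each of finitely many small cells holds at most one point. *)
Lemma unif_discrete_finite (R : realType) (d : nat) (A : set 'rV[R]_d) (delta r : R) :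
  0 < delta -> (forall x y, A x -> A y -> `|x - y| < delta -> x = y) ->
  (forall x, A x -> `|x| <= r) -> finite_set A.
Proof.
move=> d0 Ad Ar; have [T [cell cellP]] := small_cells d r d0.
apply: (@sub_finite_set _ _ ((fun t => xget 0 [set x | A x /\ cell x = t]) @` setT)).
  move=> x Ax; exists (cell x) => //.
  have : [set y | A y /\ cell y = cell x] x by [].
  move=> /(@xgetI _ 0)[Ay cy].
  by apply: (Ad _ _ Ay Ax); apply: cellP => //; exact: Ar.
by apply: finite_image; exact: finite_finset.
Qed.

Lemma finite_net (R : realType) (d : nat) (r delta : R) : 0 < delta ->
  exists W : seq 'rV[R]_d, forall y, `|y| <= r -> exists2 w, w \in W & `|y - w| < delta.
Proof.
move=> d0; have [T [cell cellP]] := small_cells d r d0.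
exists [seq xget 0 [set x | `|x| <= r /\ cell x = t] | t : T] => y yr.
have : [set x | `|x| <= r /\ cell x = cell y] y by [].
move=> /(@xgetI _ 0)[xr cx]; set x := xget _ _ in xr cx.
by exists x; [apply/fintype.imageP; exists (cell y) | apply: cellP].
Qed.

Section Sums.
Variables (R : realType) (d : nat) (D : set 'rV[R]_d).
Hypotheses (D0 : D 0) (DN : forall x, D x -> D (- x)).

(** [iter m (sumset D) D] has m + 1 summands, hence the successor in the index. *)
Lemma iter_sumset_add m m' x y :
  iter m (sumset D) D x -> iter m' (sumset D) D y -> iter (m + m').+1 (sumset D) D (x + y).
Proof.
elim: m x => [|m IH] x; first by move=> Dx Dy; exists x => //; exists y.
move=> [a Da [b Db <-]] Dy; exists a => //; exists (b + y); first exact: IH.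
by rewrite addrA.
Qed.

Lemma iter_sumset_opp m x : iter m (sumset D) D x -> iter m (sumset D) D (- x).
Proof.
elim: m x => [|m IH] x /=; first exact: DN.
move=> [a Da [b Db <-]]; exists (- a); first exact: DN.
by exists (- b); [exact: IH | rewrite opprD].
Qed.

Lemma iter_sumset_mono m m' x : (m <= m')%N ->
  iter m (sumset D) D x -> iter m' (sumset D) D x.
Proof.
move=> /subnK <-; elim: (m' - m)%N => [|k IH] // /IH Dx.
by exists 0 => //; exists x => //; rewrite add0r.
Qed.

(** Here [m] depends on [z]; a uniform bound comes later from relative density. *)
Lemma int_span_sumset (N : nat) (V : 'M[R]_(N, d)) (z : 'rV[int]_N) :
  (forall i, D (row i V)) -> exists m, iter m (sumset D) D (intmx z *m V).
Proof.
move=> DV; rewrite mulmx_sum_row.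
have scale i (a : int) : exists m, iter m (sumset D) D (a%:~R *: row i V).
  have nat_scale (k : nat) : exists m, iter m (sumset D) D (k%:R *: row i V).
    elim: k => [|k [m IH]]; first by exists 0%N; rewrite scale0r.
    exists (m + 0).+1; rewrite -natr1 scalerDl scale1r.
    exact: iter_sumset_add.
  case: a => k; first exact: nat_scale.
  have [m /iter_sumset_opp Dm] := nat_scale k.+1.
  by exists m; rewrite NegzE mulrNz scaleNr.
elim/big_ind: _ => [|x y [m Dx] [m' Dy]|i _]; first by exists 0%N.
  by exists (m + m').+1; exact: iter_sumset_add.
by rewrite mxE.
Qed.

End Sums.

(** The integer coordinates of [z] are recovered through [invmx B]; a vector shorter than the
    inverse of a bound for the entries of [invmx B] makes them all smaller than 1 in modulus. *)
Lemma int_lattice_discrete (R : realType) (d : nat) (B : 'M[R]_d) : B \in unitmx ->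
  exists2 delta : R, 0 < delta & forall z : 'rV[int]_d, `|intmx z *m B| < delta -> z = 0.
Proof.
move=> Bu; pose c : R := (\sum_i \sum_j `|invmx B i j|) + 1.
have s0 (f : 'I_d -> 'I_d -> R) : 0 <= \sum_i \sum_j `|f i j|.
  by apply: sumr_ge0 => i _; apply: sumr_ge0.
have c0 : 0 < c by rewrite ltr_wpDl // s0.
exists c^-1 => [|z]; rewrite ?invr_gt0 // -[c^-1]mul1r ltr_pdivlMr // => zB.
apply/rowP => i; rewrite !mxE.
suff : `|(z 0 i)%:~R : R| < 1.
  by rewrite -intr_norm -[1]/(1%:~R) ltr_int; case: (z 0 i) => [[|k]|k].
have -> : (z 0 i)%:~R = \sum_j (intmx z *m B) 0 j * invmx B j i.
  by have := mulmxK Bu (intmx z); move=> /rowP/(_ i); rewrite !mxE.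
apply: le_lt_trans zB; apply: le_trans (ler_norm_sum _ _ _) _.
apply: (@le_trans _ _ (\sum_j `|intmx z *m B| * `|invmx B j i|)).
  by apply: ler_sum => j _; rewrite normrM ler_wpM2r // coord_le_norm.
rewrite -mulr_sumr ler_wpM2l // /c -[leLHS]addr0 lerD //.
apply: ler_sum => j _; rewrite (bigD1 i) //= lerDl.
by apply: sumr_ge0.
Qed.

(** * Differences of a relatively dense, repetitive set invariant under a homothety *)

Section LatticeInSums.
Variables (R : realType) (d q : nat) (C : set 'rV[R]_d) (R0 : R).
Let D : set 'rV[R]_d := [set v | exists c c', [/\ C c, C c' & v = c' - c]].
Hypotheses (q1 : (1 < q)%N) (Cq : forall c, C c -> C (q%:R *: c)).
Hypothesis Cdense : forall y, exists2 c, C c & `|c - y| <= R0.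
Hypothesis Cfinite : forall rho, finite_set [set v | D v /\ `|v| <= rho].
Hypothesis Crep : forall rho, exists R1, forall c c', C c -> C c' -> `|c' - c| <= rho ->
  forall y, exists t, [/\ C (c + t), C (c' + t) & `|c + t - y| <= R1].

Let R00 : 0 <= R0.
Proof. by have [c _ /(le_trans _)] := Cdense 0; apply. Qed.

Let rho0 := 2 * R0 + 1.

(** Walk back from [c'] towards [c]. When the distance exceeds [rho0], a point of [C] within [R0] of
    the point at distance R0 + 1 from [c'] on the segment is one short difference away from [c'] and
    at least 1 closer to [c]. *)
Let gen_chain (N : nat) (V : 'M[R]_(N, d)) :
  (forall v, D v -> `|v| <= rho0 -> exists i, v = row i V) ->
  forall m c c', C c -> C c' -> `|c' - c| <= m%:R ->
  exists2 l : seq 'I_N, (size l <= m)%N & c' - c = \sum_(i <- l) row i V.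
Proof.
move=> Vgen; elim=> [|m IH] c c' Cc Cc' cc'.
  exists [::] => //; rewrite big_nil; apply/eqP.
  by rewrite -normr_le0.
have [small|large] := leP `|c' - c| rho0.
  have [|i vi] := Vgen (c' - c) _ small; first by exists c, c'.
  by exists [:: i] => //; rewrite big_seq1.
set D' := `|c' - c| in cc' large.
have D0 : 0 < D' by apply: lt_trans large; rewrite /rho0; have := R00; lra.
pose y := c' - ((R0 + 1) / D') *: (c' - c).
have [c'' Cc'' c''y] := Cdense y.
have [|l sl lE] := IH c c'' Cc Cc''.
  have -> : c'' - c = (c'' - y) + (1 - (R0 + 1) / D') *: (c' - c).
    by rewrite /y scalerBl scale1r; apply/rowP => j; rewrite !mxE; ring.
  apply: le_trans (ler_normD _ _) _; rewrite normrZ -/D' ger0_norm; last first.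
    by rewrite subr_ge0 ler_pdivrMr // mul1r ltW // (le_lt_trans _ large) // /rho0; have := R00; lra.
  rewrite mulrBl mul1r divfK ?gt_eqF //.
  by move: cc' c''y; rewrite -natr1; lra.
have [||i vi] := Vgen (c' - c''); first by exists c'', c'.
  have -> : c' - c'' = ((R0 + 1) / D') *: (c' - c) - (c'' - y).
    by rewrite /y; apply/rowP => j; rewrite !mxE; ring.
  apply: le_trans (ler_normB _ _) _; rewrite normrZ -/D' ger0_norm; last first.
    by rewrite divr_ge0 // ?ltW // ltr_wpDl.
  by rewrite divfK ?gt_eqF // /rho0; move: c''y; lra.
exists (i :: l); first by rewrite /= ltnS.
by rewrite big_cons -lE -vi; apply/rowP => j; rewrite !mxE; ring.
Qed.

(** A nonzero [w] orthogonal to all rows would be orthogonal to all differences, whereas relative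
    density provides points of [C] far away in the direction of [w]. *)
Let gen_full (N : nat) (V : 'M[R]_(N, d)) :
  (forall c c', C c -> C c' -> exists l : seq 'I_N, c' - c = \sum_(i <- l) row i V) ->
  row_full V.
Proof.
move=> Vgen; rewrite -cokermx_eq0; apply/eqP/matrixP => i0 j0.
pose w := col j0 (cokermx V).
have Vw : V *m w = 0 by rewrite /w colE mulmxA mulmx_coker mul0mx.
suff w0 : w = 0 by have /matrixP/(_ i0 0) := w0; rewrite !mxE.
apply: trmx_inj; rewrite trmx0; apply/eqP/negP => wn0.
have dot0 c c' : C c -> C c' -> dotv (c' - c) w^T = 0.
  move=> Cc Cc'; have [l ->] := Vgen _ _ Cc Cc'.
  rewrite /dotv trmxK mulmx_suml summxE big1 // => i _.
  by rewrite -row_mul Vw row0 mxE.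
have ww : 0 < dotv w^T w^T.
  by apply: lt_le_trans (norm_sqr_le_dotv _); rewrite exprn_gt0 // normr_gt0; apply/negP.
have [c0 Cc0 _] := Cdense 0.
pose b := \sum_i `|w^T 0 i| * R0.
pose t := (b + 1) / dotv w^T w^T.
have [c Cc cy] := Cdense (c0 + t *: w^T).
have := dot0 _ _ Cc0 Cc.
have -> : c - c0 = (c - (c0 + t *: w^T)) + t *: w^T.
  by apply/rowP => j; rewrite !mxE; ring.
rewrite dotvDl dotvZl /t divfK ?gt_eqF //.
suff : - b <= dotv (c - (c0 + t *: w^T)) w^T by lra.
rewrite lerNl; apply: le_trans (ler_norm _) _; rewrite normrN dotvE.
apply: le_trans (ler_norm_sum _ _ _) _; apply: ler_sum => i _.
rewrite normrM mulrC ler_wpM2l //; apply: le_trans cy; exact: coord_le_norm.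
Qed.

(** [g] induces an additive function [gh] on the integer span of the rows, whose increments on [C]
    obey the extremal slope lemma. Near some [m] they are almost linear with gradient [u], and by
    [Crep] every row of [V] occurs as a difference near [m]. So [g] is close to the linear form of
    [u] on all rows at once, and linear forms respect real relations. *)
Let gen_linear (N : nat) (V : 'M[R]_(N, d)) :
  (forall i, D (row i V) /\ `|row i V| <= rho0) ->
  (forall m c c', C c -> C c' -> `|c' - c| <= m%:R ->
  exists2 l : seq 'I_N, (size l <= m)%N & c' - c = \sum_(i <- l) row i V) ->
  forall g : 'cV[R]_N,
     (forall z : 'rV[int]_N, (intmx z : 'rV[R]_N) *m V = 0 -> (intmx z : 'rV[R]_N) *m g = 0) ->
     forall r : 'rV[R]_N, r *m V = 0 -> r *m g = 0.
Proof.
move=> VD Vgen g gker r rV.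
(* Well defined on the span because [g] kills the integer relations; elsewhere the value is the
   default 0. *)
pose gh (x : 'rV[R]_d) : R := xget 0 [set t | exists z : 'rV[int]_N,
  x = intmx z *m V /\ t = (intmx z *m g) 0 0].
have ghE (z : 'rV[int]_N) : gh (intmx z *m V) = (intmx z *m g) 0 0.
  rewrite /gh; set P := [set t | _].
  have : P ((intmx z *m g) 0 0) by exists z.
  move=> /(@xgetI _ 0)[z' [zz' ->]].
  have /gker/matrixP/(_ 0 0) : (intmx (z' - z) : 'rV[R]_N) *m V = 0.
    by rewrite map_mxB mulmxBl -zz' subrr.
  by rewrite map_mxB mulmxBl !mxE => /subr0_eq.
have spanE c c' : C c -> C c' -> exists2 z : 'rV[int]_N, c' - c = intmx z *m V &
    `|(intmx z *m g) 0 0| <= (\sum_i `|g i 0|) * (`|c' - c| + 1).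
  move=> Cc Cc'; have := truncn_itv (normr_ge0 (c' - c)); set k := Num.truncn _ => /andP[k1 k2].
  have [l sl lE] := Vgen k.+1 _ _ Cc Cc' (ltW k2).
  have intd (i : 'I_N) : intmx (delta_mx 0 i : 'rV[int]_N) = delta_mx 0 i :> 'rV[R]_N.
    by apply/rowP => j; rewrite !mxE; case: (_ && _).
  exists (\sum_(i <- l) delta_mx 0 i).
    rewrite lE raddf_sum mulmx_suml; apply: eq_bigr => i _.
    by rewrite /= intd -rowE.
  rewrite raddf_sum mulmx_suml summxE.
  apply: (@le_trans _ _ (\sum_(i <- l) \sum_j `|g j 0|)).
    apply: le_trans (ler_norm_sum _ _ _) _; apply: ler_sum => i _.
    rewrite /= intd -rowE mxE (bigD1 i) //= lerDl; exact: sumr_ge0.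
  rewrite big_const_seq count_predT iter_addr_0 -mulr_natr ler_wpM2l ?sumr_ge0 //.
  apply: (@le_trans _ _ k.+1%:R); first by rewrite ler_nat.
  by rewrite -natr1 lerD2r.
pose F a b := gh (b - a).
have FD a b c : C a -> C b -> C c -> F a c = F a b + F b c.
  move=> Ca Cb Cc; rewrite /F.
  have [z zE _] := spanE _ _ Ca Cb; have [z' zE' _] := spanE _ _ Cb Cc.
  have -> : c - a = intmx (z + z') *m V.
    by rewrite map_mxD mulmxDl -zE -zE'; apply/rowP => j; rewrite !mxE; ring.
  by rewrite zE zE' !ghE map_mxD mulmxDl mxE.
have FZ a b : C a -> C b -> F (q%:R *: a) (q%:R *: b) = q%:R * F a b.
  move=> Ca Cb; rewrite /F -scalerBr; have [z zE _] := spanE _ _ Ca Cb.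
  have qz : intmx (q%:R *: z) = q%:R *: intmx z :> 'rV[R]_N.
    by apply/rowP => j; rewrite !mxE intrM natz.
  by rewrite zE scalemxAl -qz !ghE qz -scalemxAl mxE.
have FM a b : C a -> C b -> `|F a b| <= (\sum_i `|g i 0|) * (`|b - a| + 1).
  by move=> Ca Cb; rewrite /F; have [z zE zg] := spanE _ _ Ca Cb; rewrite zE ghE -zE.
have [R1 rep] := Crep rho0.
suff close (eps : R) : 0 < eps -> `|(r *m g) 0 0| <= (\sum_i `|r 0 i|) * eps.
  apply/matrixP => i j; rewrite !ord1 [RHS]mxE; apply/eqP; rewrite -normr_le0.
  apply/ler_addgt0Pr => e e0; rewrite add0r.
  have s0 : 0 < (\sum_i `|r 0 i|) + 1 by rewrite ltr_wpDl // sumr_ge0.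
  apply: (le_trans (close (e / ((\sum_i `|r 0 i|) + 1)) _)); first by rewrite divr_gt0.
  by rewrite mulrA ler_pdivrMr // mulrC ler_wpM2l ?(ltW e0) // lerDl.
move=> eps0.
(* Room for a base point within [R1] of [m] and a difference of norm at most [rho0]. *)
pose rr := `|R1| + rho0 + 1.
have rho00 : 0 <= rho0 by rewrite /rho0; have := R00; lra.
have rr0 : 0 < rr by rewrite /rr; have := normr_ge0 R1; lra.
have [m [u mu]] := extremal_slope_linear q1 Cq FD FZ FM rr0 eps0.
have rowlin i : `|g i 0 - dotv (row i V) u| <= eps.
  have [[c [c' [Cc Cc' vE]]] vr] := VD i.
  have [|t [Ct Ct' ty]] := rep _ _ Cc Cc' _ m; first by rewrite -vE.
  have tc : (c' + t) - (c + t) = row i V.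
    by rewrite vE; apply/rowP => j; rewrite !mxE; ring.
  have -> : g i 0 = F (c + t) (c' + t).
    have intd : intmx (delta_mx 0 i : 'rV[int]_N) = delta_mx 0 i :> 'rV[R]_N.
      by apply/rowP => j; rewrite !mxE; case: (_ && _).
    by rewrite /F tc rowE -intd ghE intd -rowE mxE.
  rewrite -tc; apply: mu => //.
    by apply: le_trans ty _; rewrite /rr; have := ler_norm R1; lra.
  have -> : c' + t - m = (c + t - m) + row i V.
    by rewrite -tc; apply/rowP => j; rewrite !mxE; ring.
  apply: le_trans (ler_normD _ _) _; rewrite /rr; have := ler_norm R1; lra.
have -> : (r *m g) 0 0 = \sum_i r 0 i * (g i 0 - dotv (row i V) u).
  have e0 : \sum_i r 0 i * dotv (row i V) u = 0.
    rewrite -[RHS](dotv0l u) -rV mulmx_sum_row /dotv mulmx_suml summxE.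
    by apply: eq_bigr => i _; rewrite -scalemxAl [RHS]mxE.
  by under [RHS]eq_bigr do rewrite mulrBr; rewrite sumrB e0 subr0 mxE.
rewrite mulr_suml; apply: le_trans (ler_norm_sum _ _ _) _; apply: ler_sum => i _.
by rewrite normrM ler_wpM2l.
Qed.

(** [B1] spans a lattice containing all differences, and the rows of [B2] are [d] independent
    differences. For a vector [w] of the lattice of [B2], some difference c - c0 lies within [R0] of
    [w]; the remainder is one of finitely many vectors, so one number of summands serves all [w]. *)
Lemma lattice_in_sums : exists (B1 B2 : 'M[R]_d) (M : nat),
  [/\ B1 \in unitmx, B2 \in unitmx,
      forall v, D v -> exists z : 'rV[int]_d, v = intmx z *m B1,
      forall z : 'rV[int]_d, exists z' : 'rV[int]_d, intmx z *m B2 = intmx z' *m B1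
    & forall z : 'rV[int]_d, iter M (sumset D) D (intmx z *m B2)].
Proof.
have D0 : D 0 by have [c Cc _] := Cdense 0; exists c, c; rewrite subrr.
have DN x : D x -> D (- x) by move=> [c [c' [Cc Cc' ->]]]; exists c', c; rewrite opprB.
have [s sE] := (finite_seqP _).1 (Cfinite rho0).
pose V : 'M[R]_(size s, d) := \matrix_i s`_i.
have VD i : D (row i V) /\ `|row i V| <= rho0.
  have : [set` s] (row i V) by rewrite /= rowK mem_nth.
  by rewrite -sE.
have Vgen v : D v -> `|v| <= rho0 -> exists i, v = row i V.
  move=> Dv vr; have : [set` s] v by rewrite -sE.
  rewrite /= -index_mem => vs; exists (Ordinal vs).
  by rewrite rowK /= nth_index // -index_mem.
have chain := gen_chain Vgen.
have chain' c c' : C c -> C c' -> exists l : seq 'I_(size s), c' - c = \sum_(i <- l) row i V.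
  move=> Cc Cc'; have := truncn_itv (normr_ge0 (c' - c)); set k := Num.truncn _ => /andP[_ k2].
  by have [l _ lE] := chain k.+1 _ _ Cc Cc' (ltW k2); exists l.
have Vfull := gen_full chain'.
have [A [B1 [B1u VE]]] := rational_row_space Vfull (gen_linear VD chain).
pose f := fullrankfun Vfull.
pose B2 := rowsub f V.
have B2u : B2 \in unitmx by exact: fullrowsub_unit.
have rowB1 i : exists z : 'rV[int]_d, row i V = intmx z *m B1.
  by exists (row i A); rewrite VE row_mul map_row.
have sumB1 l : exists z : 'rV[int]_d, \sum_(i <- l) row i V = intmx z *m B1.
  elim: l => [|i l [z zE]]; first by exists 0; rewrite big_nil map_mx0 mul0mx.
  have [z' zE'] := rowB1 i; exists (z' + z).
  by rewrite big_cons zE zE' map_mxD mulmxDl.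
have DB1 v : D v -> exists z : 'rV[int]_d, v = intmx z *m B1.
  by move=> [c [c' [Cc Cc' ->]]]; have [l ->] := chain' _ _ Cc Cc'; exact: sumB1.
have B2V (z : 'rV[int]_d) : exists z' : 'rV[int]_(size s), intmx z *m B2 = intmx z' *m V.
  exists (z *m rowsub f 1%:M); rewrite map_mxM -mulmxA; congr (_ *m _).
  by rewrite map_mxsub map_mx1 mul_rowsub_mx mul1mx.
have VB1 (z : 'rV[int]_(size s)) : exists z' : 'rV[int]_d, intmx z *m V = intmx z' *m B1.
  by exists (z *m A); rewrite VE map_mxM mulmxA.
have [c0 Cc0 _] := Cdense 0.
(* The possible remainders, finitely many because they lie in the lattice of [B1]. *)
pose E := [set x | `|x| <= R0 /\ exists z : 'rV[int]_(size s), x = intmx z *m V].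
have Efin : finite_set E.
  have [delta delta0 deltaP] := int_lattice_discrete B1u.
  apply: (unif_discrete_finite delta0 _ (r := R0)) => [x y [_ [z ->]] [_ [z' ->]]|x []//].
  have [w ->] := VB1 z; have [w' ->] := VB1 z'.
  rewrite -mulmxBl -map_mxB => /deltaP => /subr0_eq -> //.
have [M0 M0P] : exists M0, forall x, E x -> iter M0 (sumset D) D x.
  have [es esE] := (finite_seqP _).1 Efin.
  have : forall x, x \in es -> exists m, iter m (sumset D) D x.
    move=> x xes; have : E x by rewrite esE.
    by move=> [_ [z ->]]; apply: int_span_sumset => // i; exact: (VD i).1.
  rewrite esE; elim: es {esE} => [|x es IH] xes; first by exists 0%N.
  have [|M0 M0P] := IH; first by move=> y yes; apply: xes; rewrite inE yes orbT.
  have [m mx] := xes x (mem_head _ _).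
  exists (maxn m M0) => y /=; rewrite inE => /orP[/eqP ->|yes].
    exact: iter_sumset_mono (leq_maxl _ _) mx.
  by apply: iter_sumset_mono (leq_maxr _ _) _ => //; exact: M0P.
exists B1, B2, M0.+1; split => // z; first by have [z' ->] := B2V z; exact: VB1.
have [c Cc cz] := Cdense (c0 + intmx z *m B2).
have [z' zE'] := B2V z.
have [l lE] := chain' _ _ Cc0 Cc.
exists (c - c0); first by exists c0, c.
exists (intmx z *m B2 - (c - c0)); last by rewrite addrC subrK.
apply: M0P; split.
  suff -> : intmx z *m B2 - (c - c0) = - (c - (c0 + intmx z *m B2)) by rewrite normrN.
  by move: (intmx z *m B2) => u; apply/rowP => j; rewrite !mxE; ring.
pose zl : 'rV[int]_(size s) := \sum_(i <- l) delta_mx 0 i.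
exists (z' - zl); rewrite map_mxB mulmxBl -zE' lE; congr (_ - _).
rewrite raddf_sum mulmx_suml; apply: eq_bigr => i _ /=.
have -> : intmx (delta_mx 0 i : 'rV[int]_(size s)) = delta_mx 0 i :> 'rV[R]_(size s).
  by apply/rowP => j; rewrite !mxE; case: (_ && _).
by rewrite -rowE.
Qed.

End LatticeInSums.

Local Notation shift := Defs.shift.

(** * Translates of tiles *)

Section TileAlgebra.
Variables (R : realType) (d : nat) (Lab : finType).
Implicit Types (x y z : 'rV[R]_d) (S : set 'rV[R]_d) (T : tile R d Lab) (P : set (tile R d Lab)).

Lemma in_shift S x y : shift S x y = S (y - x).
Proof.
apply/propext; split; first by move=> [z Sz <-]; rewrite addrK.
by move=> Sy; exists (y - x) => //; rewrite subrK.
Qed.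

Lemma trE T x y : (tr T x).1 y = T.1 (y - x).
Proof. exact: in_shift. Qed.

Lemma tr_add T x y : tr (tr T x) y = tr T (x + y).
Proof.
rewrite /tr /=; congr (_, _); apply/funext => z.
by rewrite !in_shift opprD addrA addrAC.
Qed.

Lemma tr0 T : tr T 0 = T.
Proof.
rewrite [RHS]surjective_pairing /tr; congr (_, _); apply/funext => z.
by rewrite in_shift subr0.
Qed.

Lemma trK T x : tr (tr T x) (- x) = T.
Proof. by rewrite tr_add subrr tr0. Qed.

Lemma ptrE P x T : ptr P x T = P (tr T (- x)).
Proof.
apply/propext; split; first by move=> [T' PT' <-]; rewrite trK.
by move=> PT; exists (tr T (- x)) => //; rewrite tr_add addNr tr0.
Qed.

Lemma ptr_add P x y : ptr (ptr P x) y = ptr P (x + y).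
Proof. by apply/funext => T; rewrite !ptrE tr_add opprD addrC. Qed.

Lemma ptr0 P : ptr P 0 = P.
Proof. by apply/funext => T; rewrite ptrE oppr0 tr0. Qed.

Lemma interiorP S x : interior S x <-> exists2 e, 0 < e & forall y, `|y - x| < e -> S y.
Proof.
split=> [/nbhs_ballP[e e0 eS]|[e e0 eS]].
  by exists e => // y yx; apply: eS; rewrite -ball_normE /ball_ /= distrC.
by apply/nbhs_ballP; exists e => // y; rewrite -ball_normE /ball_ /= distrC => /eS.
Qed.

Lemma in_ball0 (r : R) (y : 'rV[R]_d) : ball (0 : 'rV[R]_d) r y <-> `|y| < r.
Proof. by rewrite -[ball]ball_normE /ball_ /= sub0r normrN. Qed.

Definition contains_ball T (y : 'rV[R]_d) (e : R) := forall z, `|z - y| < e -> T.1 z.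

(** A tile is the closure of its interior, so an interior point [y'] lies within [e] of [y]; the
    radius is then cut down to stay within [e] of [y]. *)
Lemma is_tile_tr T x : is_tile T -> forall y, (tr T x).1 y -> forall e, 0 < e ->
  exists y' e', [/\ 0 < e', contains_ball (tr T x) y' e' & forall z, `|z - y'| < e' -> `|z - y| < e].
Proof.
move=> [_ [Treg _]] y; rewrite trE Treg => /= cl e e0.
have [|y' [/interiorP[e' e'0 y'T]]] := cl (ball (y - x) e); first exact: nbhsx_ballx.
rewrite -[ball]ball_normE /ball_ /= => y'y.
pose e2 := Num.min e' (e - `|y - x - y'|).
exists (y' + x), e2; split.
- by rewrite /e2 lt_min e'0 subr_gt0.
- move=> z; rewrite /e2 lt_min => /andP[ze' _]; rewrite trE; apply: y'T.
  by rewrite -addrA -opprD [x + y']addrC.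
- move=> z; rewrite /e2 lt_min => /andP[_ ze].
  have -> : z - y = (z - (y' + x)) - (y - x - y') by apply/rowP => j; rewrite !mxE; ring.
  by apply: le_lt_trans (ler_normB _ _) _; lra.
Qed.

(** A nonzero period [w] would carry a point [p] of the tile to p - k w for all [k], against
    boundedness. *)
Lemma tr_tile_inj T x y : is_tile T -> tr T x = tr T y -> x = y.
Proof.
move=> [/compact_bounded[M [_ /(_ (M + 1))Mb]] [_ [p Tp]]] /(congr1 (fun U => tr U (- x))).
rewrite trK tr_add => E; apply/eqP; rewrite eq_sym -subr_eq0; set w := y - x in E *.
have {Mb} Mb q : T.1 q -> `|q| <= M + 1 by apply: Mb; rewrite ltrDl.
have it k : T.1 (p - k%:R *: w).
  elim: k => [|k IH]; first by rewrite scale0r subr0.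
  move: IH; rewrite {1}E trE => IH.
  by rewrite -natr1 scalerDl scale1r opprD addrA.
apply/negPn/negP => w0; have wn : 0 < `|w| by rewrite normr_gt0.
pose k := (Num.truncn ((M + 1 + `|p|) / `|w|)).+1.
have : (M + 1 + `|p|) / `|w| < k%:R by rewrite /k; exact: truncnS_gt.
rewrite ltr_pdivrMr // ltNge => /negP; apply.
have -> : k%:R * `|w| = `|p - (p - k%:R *: w)| by rewrite subKr normrZ ger0_norm.
by apply: le_trans (ler_normB _ _) _; rewrite addrC lerD2r; exact: Mb.
Qed.

Lemma compact_cball0 (r : R) : compact [set y : 'rV[R]_d | `|y| <= r].
Proof.
apply: bounded_closed_compact.
  by exists r; split; [exact: num_real | move=> M rM y /= yr; rewrite (le_trans yr) ?ltW].
have -> : [set y : 'rV[R]_d | `|y| <= r] = (fun y : 'rV[R]_d => `|y|) @^-1` [set t : R | t <= r] by [].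
by apply: closed_comp => [y _|]; [exact: norm_continuous | exact: closed_le].
Qed.

End TileAlgebra.

(** * Measures on the hull *)

Section ProbabilityBounds.
Variables (disp : measure_display) (T : measurableType disp) (R : realType) (mu : probability T R).
Implicit Types A B : set T.

Definition pr A : R := fine (mu A).

Lemma prE A : measurable A -> mu A = (pr A)%:E.
Proof. by move=> mA; rewrite /pr fineK // fin_num_measure. Qed.

Lemma pr_ge0 A : 0 <= pr A.
Proof. by rewrite /pr fine_ge0. Qed.

Lemma pr_congr A B : mu A = mu B -> pr A = pr B.
Proof. by rewrite /pr => ->. Qed.

Lemma pr_le A B : measurable A -> measurable B -> A `<=` B -> pr A <= pr B.
Proof. by move=> mA mB AB; rewrite -lee_fin -!prE // le_measure ?inE. Qed.

Lemma pr_setU A B : measurable A -> measurable B -> pr (A `|` B) <= pr A + pr B.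
Proof.
by move=> mA mB; rewrite -lee_fin EFinD -!prE //; [exact: measureU2 | exact: measurableU].
Qed.

Lemma pr_set0 : pr set0 = 0.
Proof. by rewrite /pr measure0. Qed.

Lemma pr_setC A : measurable A -> pr (~` A) = 1 - pr A.
Proof. by move=> mA; rewrite /pr probability_setC // fineB ?fin_num_measure. Qed.

Lemma pr_cover (I : eqType) (W : seq I) (F : I -> set T) (A : set T) (c : R) :
  measurable A -> (forall w, measurable (F w)) -> (forall w, pr (F w) <= c) ->
  (forall x, A x -> exists2 w, w \in W & F w x) -> pr A <= (size W)%:R * c.
Proof.
move=> mA mF Fc; elim: W A mA => [|w W IH] A mA AF.
  rewrite mul0r; have -> : A = set0 by apply/seteqP; split=> x // /AF[].
  by rewrite pr_set0.
have mAw : measurable (A `\` F w) by exact: measurableD.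
have AwF : forall x, (A `\` F w) x -> exists2 w, w \in W & F w x.
  move=> x [/AF[w']]; rewrite inE => /orP[/eqP -> //|w'W Fx _]; by exists w'.
have le1 := IH _ mAw AwF.
have : pr A <= pr (F w `|` (A `\` F w)).
  apply: pr_le => //; first exact: measurableU.
  by move=> x Ax; have [?|?] := pselect (F w x); [left | right].
have := pr_setU (mF w) mAw; have := Fc w.
by rewrite /= -natr1 mulrDl mul1r; lra.
Qed.

(** Continuity of the measure from above, at the empty set. *)
Lemma pr_decreasing (F : nat -> set T) (eps : R) : (forall k, measurable (F k)) ->
  (forall k l, (k <= l)%N -> F l `<=` F k) -> (forall x, exists k, ~ F k x) -> 0 < eps ->
  exists k, pr (F k) < eps.
Proof.
move=> mF Fdec F0 eps0.
have cap0 : \bigcap_k F k = set0.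
  by apply/seteqP; split=> x // Fx; have [k] := F0 x; apply; exact: Fx.
have cvg : (mu \o F) k @[k --> \oo] --> mu (\bigcap_k F k).
  apply: nonincreasing_cvg_mu => //.
  - by rewrite (le_lt_trans (probability_le1 mu (mF 0%N))) // ltey.
  - by rewrite cap0.
  - by move=> k l kl; apply/subsetPset/Fdec.
rewrite cap0 measure0 in cvg.
have [k _ /(_ k (leqnn k)) ?] := cvgr_lt _ (fine_cvg cvg) _ eps0.
by exists k.
Qed.

Lemma measurable_ge (g : T -> R) (t : R) : measurable_fun setT g -> measurable [set x | t <= g x].
Proof.
move=> mg; rewrite -[X in measurable X]setTI.
have -> : [set x | t <= g x] = g @^-1` `[t, +oo[.
  by apply/funext => x; rewrite /= in_itv /= andbT.
exact: mg.
Qed.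

Lemma pr_tail (g : T -> R) (eps : R) : measurable_fun setT g -> 0 < eps ->
  exists k : nat, pr [set x | k%:R <= g x] < eps.
Proof.
move=> mg eps0; apply: pr_decreasing => // [k|k l kl x /= lx|x].
- exact: measurable_ge.
- by apply: le_trans lx; rewrite ler_nat.
- exists (Num.truncn `|g x|).+1; apply/negP; rewrite -ltNge.
  by apply: le_lt_trans (ler_norm _) _; exact: truncnS_gt.
Qed.

(** A measurable null set is extracted because exceptional sets are later translated and their
    probabilities added. *)
Lemma pr_ae_null (P : T -> Prop) : {ae mu, forall x, P x} ->
  exists N, [/\ measurable N, pr N = 0 & forall x, ~ N x -> P x].
Proof.
move=> [N [mN muN PN]]; exists N; split => //; first by rewrite /pr muN.
by move=> x; apply: contra_notP => nP; exact: PN.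
Qed.

Lemma pr_markov (g : T -> R) (t c : R) : measurable_fun setT g -> (forall x, 0 <= g x) -> 0 < t ->
  (\int[mu]_x (g x)%:E < c%:E)%E -> pr [set x | t <= g x] <= c / t.
Proof.
move=> mg g0 t0 intc; rewrite ler_pdivlMr // mulrC -lee_fin EFinM -prE; last exact: measurable_ge.
have /measurable_EFinP mgE := mg.
have := le_integral_abse mu measurableT mgE t0.
rewrite setTI; have -> : [set x | (t%:E <= `|(g x)%:E|)%E] = [set x | t <= g x].
  by apply/funext => x; rewrite /= lee_fin ger0_norm.
move=> /le_trans; apply; apply: le_trans (ltW intc).
by rewrite (eq_integral (fun x => (g x)%:E)) // => x _; rewrite gee0_abs // lee_fin.
Qed.

End ProbabilityBounds.

(** * The local matching topology, and measurable sets read off finite windows *)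

Section HullTopology.
Variables (R : realType) (d : nat) (Lab : finType) (Tl : set (tile R d Lab)).
Local Notation vec := 'rV[R]_d.
Local Notation til := (set (tile R d Lab)).
Local Notation hs := (hull_space Tl).
Implicit Types (S : til) (r eps e : R).

(** Agreement on a window without the small displacements that [agree] allows. *)
Definition agree_on (r : R) (S S' : til) :=
  forall T, (exists2 z, T.1 z & `|z| < r) -> (S T <-> S' T).

Lemma sqcap_agree_on r S S' :
  sqcap S (ball (0 : vec) r) = sqcap S' (ball (0 : vec) r) <-> agree_on r S S'.
Proof.
split=> [E T [z Tz zr]|E].
  have zb : T.1 `&` ball (0 : vec) r !=set0 by exists z; split => //; exact/in_ball0.
  split=> ST; suff [] : (sqcap S (ball (0 : vec) r) T) /\ (sqcap S' (ball (0 : vec) r) T).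
  - by move=> _ [].
  - by rewrite -E; split; split.
  - by move=> [].
  - by rewrite E; split; split.
by apply/seteqP; split=> T [ST [z [Tz /in_ball0 zr]]];
  (split; [by apply/E => //; exists z | by exists z; split => //; apply/in_ball0]).
Qed.

Lemma agree_on_sym r S S' : agree_on r S S' -> agree_on r S' S.
Proof. by move=> E T Tz; have [h1 h2] := E T Tz; split. Qed.

Lemma agree_on_trans r S1 S2 S3 : agree_on r S1 S2 -> agree_on r S2 S3 -> agree_on r S1 S3.
Proof.
move=> E E' T Tz; have [h1 h2] := E T Tz; have [h3 h4] := E' T Tz.
by split => [/h1/h3|/h4/h2].
Qed.

Lemma agree_on_le r r' S S' : r' <= r -> agree_on r S S' -> agree_on r' S S'.
Proof. by move=> rr' E T [z Tz zr]; apply: E; exists z => //; exact: lt_le_trans rr'. Qed.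

Lemma agree_on_ptr r e S S' (x : vec) : `|x| <= e -> agree_on (r + e) S S' ->
  agree_on r (ptr S x) (ptr S' x).
Proof.
move=> xe E T [z Tz zr]; rewrite !ptrE; apply: E; exists (z - x); first by rewrite trE opprK subrK.
by apply: le_lt_trans (ler_normB _ _) _; apply: ltr_leD.
Qed.

Lemma agreeP S S' r eps : agree S S' r eps <->
  exists x y : vec, [/\ `|x| < eps, `|y| < eps & agree_on r (ptr S x) (ptr S' y)].
Proof.
split=> [[x [y [xe [ye /sqcap_agree_on E]]]]|[x [y [xe ye /sqcap_agree_on E]]]].
  by exists x, y.
by exists x, y.
Qed.

Lemma agree_refl S r eps : 0 < eps -> agree S S r eps.
Proof. by move=> e0; apply/agreeP; exists 0, 0; rewrite normr0. Qed.

Lemma agree_le S S' r eps r' eps' : r' <= r -> eps <= eps' -> agree S S' r eps -> agree S S' r' eps'.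
Proof.
move=> rr' ee' /agreeP[x [y [xe ye E]]]; apply/agreeP; exists x, y; split.
- exact: lt_le_trans ee'.
- exact: lt_le_trans ee'.
- exact: agree_on_le E.
Qed.

Lemma agree_ptr S S' r eps (x : vec) : agree S S' (r + `|x|) eps -> agree (ptr S x) (ptr S' x) r eps.
Proof.
move=> /agreeP[a [b [ae be E]]]; apply/agreeP; exists a, b; split => //.
rewrite !ptr_add ![x + _]addrC -!ptr_add; exact: agree_on_ptr E.
Qed.

Lemma agree_on_agree S S1 S2 r eps : agree S S1 r eps -> agree_on (r + eps) S1 S2 -> agree S S2 r eps.
Proof.
move=> /agreeP[a [b [ae be E]]] E12; apply/agreeP; exists a, b; split => //.
apply: agree_on_trans E _; exact: agree_on_ptr (ltW be) E12.
Qed.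

(** Displacements compose: the slack eps - |y| pays for two further ones of size [dl], and the
    window |r| + 2 eps leaves room for the correction y - u. *)
Lemma agree_open S r eps : lm_open [set S' | agree S S' r eps].
Proof.
move=> S1 /agreeP[x [y [xe ye E]]].
have e0 : 0 < eps by apply: le_lt_trans xe.
pose dl := (eps - `|y|) / 2.
have dl0 : 0 < dl by rewrite divr_gt0 // subr_gt0.
exists (`|r| + 2 * eps), dl; split; first by rewrite ltr_wpDl // mulr_gt0.
split => // S2 /agreeP[u [w [ud wd E12]]]; apply/agreeP; exists x, (w + (y - u)); split => //.
  apply: le_lt_trans (ler_normD _ _) _; have := ler_normB y u; rewrite /dl in wd ud; lra.
apply: agree_on_trans E _.
have -> : ptr S1 y = ptr (ptr S1 u) (y - u) by rewrite ptr_add addrC subrK.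
rewrite -(ptr_add S2); apply: (agree_on_ptr (e := 2 * eps)).
  apply: le_trans (ler_normB _ _) _; have := normr_ge0 y; rewrite /dl in ud; lra.
by apply: agree_on_le E12; rewrite lerD2r ler_norm.
Qed.

Lemma lm_open_bigcup (J : Type) (P : set J) (F : J -> set til) :
  (forall j, P j -> lm_open (F j)) -> lm_open (\bigcup_(j in P) F j).
Proof.
move=> oF S [j Pj FS]; have [r [e [r0 [e0 sub]]]] := oF j Pj S FS.
by exists r, e; split => //; split => // S' /sub FS'; exists j.
Qed.

Lemma lm_openT : lm_open [set: til].
Proof. by move=> S _; exists 1, 1; split => //; split. Qed.

(** The small displacements are absorbed into [z], so on a bounded window a tiling of the hull is
    exactly a translate of [Tl]. *)
Lemma hull_local S (r : R) : hull Tl S -> exists z : vec, agree_on r S (ptr Tl z).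
Proof.
move=> /(_ (`|r| + 1) 1); have r1 : 0 < `|r| + 1 :> R by rewrite ltr_wpDl.
move=> /(_ r1 ltr01)[x /agreeP[a [b [a1 b1 E]]]].
exists (x + b - a); rewrite -!ptr_add.
have -> : S = ptr (ptr S a) (- a) by rewrite ptr_add subrr ptr0.
apply: (agree_on_ptr (e := 1)); first by rewrite normrN ltW.
by apply: agree_on_le E; rewrite lerD2r ler_norm.
Qed.

Lemma hull_ptr S (x : vec) : hull Tl S -> hull Tl (ptr S x).
Proof.
move=> hS r e r0 e0; have [|y E] := hS (r + `|x|) e _ e0; first by rewrite ltr_wpDr.
exists (y + x); rewrite -ptr_add; exact: agree_ptr.
Qed.

Lemma hull_open_measurable (U : set til) : lm_open U -> measurable (U `&` hull Tl : set hs).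
Proof. by move=> oU; apply: sub_sigma_algebra; exists U. Qed.

Lemma hull_measurable : measurable (hull Tl : set hs).
Proof. by rewrite -[hull Tl]setTI; apply: hull_open_measurable; exact: lm_openT. Qed.

Lemma ptr_measurable (x : vec) : measurable_fun setT ((fun S => ptr S x) : hs -> hs).
Proof.
apply: (@measurability _ _ hs hs setT _ (hull_open Tl)) => // _ [_ [U oU <-] <-]; rewrite setTI.
have -> : ((fun S => ptr S x) : hs -> hs) @^-1` (U `&` hull Tl) =
    [set S | U (ptr S x)] `&` hull Tl.
  apply/seteqP; split=> S [US hS]; split => //.
    by have := hull_ptr (- x) hS; rewrite ptr_add subrr ptr0.
  exact: hull_ptr.
apply: hull_open_measurable => S /= /oU[r [e [r0 [e0 sub]]]].
exists (r + `|x|), e; split; first by rewrite ltr_wpDr.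
by split => // S' SS'; apply: sub; exact: agree_ptr.
Qed.

Variable mu : probability hs R.
Local Notation pr := (pr mu).

(* Up to small probability, membership in B can be read off a finite window of the tiling. *)
Definition locally_decided (B : set hs) := forall eps : R, 0 < eps ->
  exists (r : R) (D : set hs), [/\ measurable D, pr D < eps &
    forall S S', hull Tl S -> hull Tl S' -> agree_on r S S' -> ~ D S -> ~ D S' -> (B S <-> B S')].

Lemma locally_decided_setU B B' : locally_decided B -> locally_decided B' -> locally_decided (B `|` B').
Proof.
move=> dB dB' eps eps0; have e2 : 0 < eps / 2 by rewrite divr_gt0.
have [r [D [mD Dlt DP]]] := dB _ e2; have [r' [D' [mD' D'lt DP']]] := dB' _ e2.
exists (Num.max r r'), (D `|` D'); split; first exact: measurableU.
  by have := pr_setU mu mD mD'; lra.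
move=> S S' hS hS' E /not_orP[nD nD'] /not_orP[nDS' nD'S'].
have Er : agree_on r S S' by apply: agree_on_le E; rewrite le_max lexx.
have Er' : agree_on r' S S' by apply: agree_on_le E; rewrite le_max lexx orbT.
have [h1 h2] := DP _ _ hS hS' Er nD nDS'; have [h3 h4] := DP' _ _ hS hS' Er' nD' nD'S'.
by split=> -[?|?]; [left; apply: h1|right; apply: h3|left; apply: h2|right; apply: h4].
Qed.

(** By continuity of the measure, the part of [B] missed by [F k] has small probability and joins
    the exceptional set. *)
Lemma locally_decided_limit (F : nat -> set hs) (B : set hs) :
  measurable B -> (forall k, measurable (F k)) -> (forall k, locally_decided (F k)) ->
  (forall k l, (k <= l)%N -> F k `<=` F l) ->
  (forall S, hull Tl S -> B S <-> exists k, F k S) -> locally_decided (B `&` hull Tl).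
Proof.
move=> mB mF dF Finc BF eps eps0; have e2 : 0 < eps / 2 by rewrite divr_gt0.
have [k kP] : exists k, pr ((B `&` hull Tl) `\` F k) < eps / 2.
  apply: pr_decreasing => // [k|k l kl S [BS nF]|S].
  - apply: measurableD => //; apply: measurableI => //; exact: hull_measurable.
  - by split => //; apply: contra_not nF; exact: Finc.
  - have [[BS hS]|nB] := pselect ((B `&` hull Tl) S); last by exists 0%N => -[].
    by have [k FS] := (BF S hS).1 BS; exists k => -[].
have [r [D [mD Dlt DP]]] := dF k _ e2.
have mBF : measurable ((B `&` hull Tl) `\` F k).
  by apply: measurableD => //; apply: measurableI => //; exact: hull_measurable.
exists r, (D `|` ((B `&` hull Tl) `\` F k)); split; first exact: measurableU.
  by have := pr_setU mu mD mBF; lra.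
move=> S S' hS hS' E /not_orP[nD nBF] /not_orP[nDS' nBFS'].
have [h1 h2] := DP _ _ hS hS' E nD nDS'.
split=> -[BS _]; split => //; apply/BF => //; exists k.
  by apply: h1; apply: contrapT => nF; apply: nBF; split.
by apply: h2; apply: contrapT => nF; apply: nBFS'; split.
Qed.

(** [U] is exhausted by the sets [F k], unions of the neighbourhoods inside [U] of radius [rad j]
    and tolerance its inverse, for j <= k. Within the hull, membership in [F k] depends on the
    window of radius [rad k + 1], without exception. *)
Lemma hull_open_locally_decided (U : set til) : lm_open U -> locally_decided (U `&` hull Tl).
Proof.
move=> oU; pose rad k : R := k.+1%:R; pose V k := \bigcup_(S in [set S | [set S' | agree S S' (rad k) (rad k)^-1] `<=` U])
  [set S' | agree S S' (rad k) (rad k)^-1].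
have rad0 k : 0 < rad k by rewrite /rad.
pose F k := \bigcup_(j in [set j | (j <= k)%N]) V j.
have oF k : lm_open (F k).
  by apply: lm_open_bigcup => j _; apply: lm_open_bigcup => S _; exact: agree_open.
rewrite -(setIid (hull Tl)) setIA.
apply: (@locally_decided_limit (fun k => F k `&` hull Tl)).
- exact: hull_open_measurable.
- by move=> k; exact: hull_open_measurable.
- move=> k eps eps0; exists (rad k + 1), set0; rewrite pr_set0; split => //.
  suff half S S' : hull Tl S -> hull Tl S' -> agree_on (rad k + 1) S S' ->
      F k S -> F k S'.
    move=> S S' hS hS' E _ _; split=> -[FS _]; split => //; first exact: half E FS.
    exact: half (agree_on_sym E) FS.
  move=> hS hS' E [j jk [S0 S0U S0S]]; exists j => //; exists S0 => //.
  apply: (agree_on_agree S0S); apply: agree_on_le E; apply: lerD.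
    by rewrite /rad ler_nat ltnS.
  by rewrite invf_le1 // /rad ler1n.
- by move=> k l kl S [[j jk VS] hS]; split => //; exists j => //=; exact: leq_trans kl.
- move=> S hS; split=> [[US _]|[k [[j _ [S0 S0U S0S]] _]]]; last by split => //; exact: S0U.
  have [r [e [r0 [e0 sub]]]] := oU S US.
  pose k := (Num.truncn (r + e^-1)).+1.
  have kr : r + e^-1 < rad k by apply: lt_le_trans (truncnS_gt _) _; rewrite /rad ler_nat.
  have ei : 0 < e^-1 by rewrite invr_gt0.
  exists k; split => //; exists k => //=; exists S; last by apply: agree_refl; rewrite invr_gt0.
  move=> S' /= SS'; apply: sub; apply: agree_le SS'; first by lra.
  by rewrite invf_ple ?posrE //; lra.
Qed.

(** The locally decided measurable sets form a sigma-algebra containing the open sets; measurability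
    is carried along for the passage to limits in countable unions. *)
Lemma measurable_locally_decided (B : set hs) : measurable B -> locally_decided (B `&` hull Tl).
Proof.
move=> mB; suff : measurable B /\ locally_decided (B `&` hull Tl) by case.
move: B mB; apply: smallest_sub; last first.
  move=> _ [U oU <-]; split; first exact: hull_open_measurable.
  by rewrite -setIA setIid; exact: hull_open_locally_decided.
split.
- split => //; rewrite set0I => eps eps0; exists 0, set0; rewrite pr_set0; split => //.
- move=> A [mA dA]; rewrite setTD; split; first exact: measurableC.
  move=> eps eps0; have [r [D [mD Dlt DP]]] := dA _ eps0.
  exists r, D; split => // S S' hS hS' E nD nD'.
  have [h1 h2] := DP _ _ hS hS' E nD nD'.
  by split=> -[nA _]; split => // AS; apply: nA; [apply: (h2 _).1 | apply: (h1 _).1].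
- move=> A' AP; pose A : nat -> set hs := A'; have mA k : measurable (A k) by exact: (AP k).1.
  split; first exact: bigcup_measurable.
  pose F k := (\bigcup_(j in [set j | (j < k)%N]) A j) `&` hull Tl.
  apply: (@locally_decided_limit F).
  + exact: bigcup_measurable.
  + move=> k; apply: measurableI; last exact: hull_measurable.
    exact: bigcup_measurable.
  + elim=> [|k IH].
      rewrite /F (_ : [set j | (j < 0)%N] = set0); last by apply/seteqP; split.
      rewrite bigcup_set0 set0I => eps eps0; exists 0, set0; rewrite pr_set0; split => //.
    suff -> : F k.+1 = F k `|` (A k `&` hull Tl) by apply: locally_decided_setU => //; exact: (AP k).2.
    apply/seteqP; split=> S.
      move=> [[j /=]]; rewrite ltnS leq_eqVlt => /orP[/eqP -> AS hS|jk AS hS]; first by right.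
      by left; split => //; exists j.
    by move=> [[[j /= jk AS] hS]|[AS hS]]; (split => //);
      [exists j => //=; exact: ltnW | exists k => /=].
  + by move=> k l kl S [[j jk AS] hS]; split => //; exists j => //=; exact: leq_trans kl.
  + move=> S hS; split=> [[j _ AS]|[k [[j _ AS] _]]]; last by exists j.
    by exists j.+1; split => //; exists j => /=.
Qed.

(** Off a set of small probability |g| < m, and there finitely many superlevel sets, at heights eta
    / 2 apart, determine [g] up to [eta]; each of them is locally decided. *)
Lemma measurable_locally_close (g : hs -> R) : measurable_fun setT g ->
  forall eps eta : R, 0 < eps -> 0 < eta ->
  exists (r : R) (D : set hs), [/\ measurable D, pr D < eps &
    forall S S', hull Tl S -> hull Tl S' -> agree_on r S S' -> ~ D S -> ~ D S' ->
      `|g S - g S'| < eta].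
Proof.
move=> mg eps eta eps0 eta0; have e2 : 0 < eps / 2 by rewrite divr_gt0.
have mabs : measurable_fun setT (fun S : hs => `|g S|).
  exact: (measurableT_comp (@normr_measurable R setT) mg).
have [m mP] := pr_tail mu mabs e2.
have m0 := measurable_ge m%:R mabs.
pose h := eta / 2; have h0 : 0 < h by rewrite divr_gt0.
pose t (i : nat) : R := i%:R * h - m%:R.
have decided (k : nat) (e : R) : 0 < e -> exists (r : R) (D : set hs), [/\ measurable D, pr D < e &
    forall S S', hull Tl S -> hull Tl S' -> agree_on r S S' -> ~ D S -> ~ D S' ->
      forall i, (i < k)%N -> (t i <= g S) = (t i <= g S')].
  elim: k e => [|k IH] e e0.
    by exists 0, set0; rewrite pr_set0; split.
  have e20 : 0 < e / 2 by rewrite divr_gt0.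
  have [r [D [mD Dlt DP]]] := IH _ e20.
  have [r' [D' [mD' D'lt DP']]] := measurable_locally_decided (measurable_ge (t k) mg) e20.
  exists (Num.max r r'), (D `|` D'); split; first exact: measurableU.
    by have := pr_setU mu mD mD'; lra.
  move=> S S' hS hS' E /not_orP[nD nD'] /not_orP[nDS' nD'S'] i.
  have Er : agree_on r S S' by apply: agree_on_le E; rewrite le_max lexx.
  have Er' : agree_on r' S S' by apply: agree_on_le E; rewrite le_max lexx orbT.
  rewrite ltnS leq_eqVlt => /orP[/eqP ->|ik]; last exact: DP ik.
  have [h1 h2] := DP' _ _ hS hS' Er' nD' nD'S'.
  by apply/idP/idP => tg; [case: h1 | case: h2].
pose K := (Num.truncn ((m%:R + m%:R) / h)).+1.
have [r [D [mD Dlt DP]]] := decided K _ e2.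
exists r, (D `|` [set S | m%:R <= `|g S|]); split; first exact: measurableU.
  by have := pr_setU mu mD m0; lra.
suff half S S' : `|g S| < m%:R ->
    (forall i, (i < K)%N -> (t i <= g S) = (t i <= g S')) -> g S - g S' < eta.
  move=> S S' hS hS' E /not_orP[nD /negP nm] /not_orP[nD' /negP nm'].
  rewrite -ltNge in nm; rewrite -ltNge in nm'.
  have dec := DP _ _ hS hS' E nD nD'.
  have := half _ _ nm dec; have := half _ _ nm' (fun i ik => esym (dec i ik)).
  by move=> h1 h2; rewrite ltr_norml; apply/andP; split; lra.
move=> gm dec; move: (gm); rewrite ltr_norml => /andP[g1 g2].
have gh0 : 0 <= (g S + m%:R) / h by rewrite divr_ge0 ?(ltW h0) //; lra.
have := truncn_itv gh0; set i := Num.truncn _ => /andP[i1 i2].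
have iK : (i < K)%N.
  by rewrite /K ltnS /i; apply: le_truncn; rewrite ler_wpM2r ?invr_ge0 ?(ltW h0) // lerD2r ltW.
have := dec i iK; rewrite ler_pdivlMr // in i1; rewrite ltr_pdivrMr // -natr1 mulrDl mul1r in i2.
have -> : t i <= g S by rewrite /t; lra.
have etaE : eta = h + h by rewrite /h; field.
by move=> /esym; rewrite /t; lra.
Qed.

End HullTopology.

(** * The squared modulus and measurable complex functions *)

Section Complex.
Variable R : realType.
Implicit Types z w : R[i].

Lemma sqn_ge0 z : 0 <= sqn z.
Proof. by rewrite addr_ge0 // sqr_ge0. Qed.

Lemma sqnM z w : sqn (z * w) = sqn z * sqn w.
Proof. by case: z => a b; case: w => c e; rewrite /sqn /=; ring. Qed.

Lemma sqnN z : sqn (- z) = sqn z.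
Proof. by case: z => a b; rewrite /sqn /=; ring. Qed.

Lemma sqn1 : sqn (1 : R[i]) = 1.
Proof. by rewrite /sqn /=; ring. Qed.

Lemma sqn0 : sqn (0 : R[i]) = 0.
Proof. by rewrite /sqn /=; ring. Qed.

Lemma sqnD_le z w : sqn (z + w) <= 2 * sqn z + 2 * sqn w.
Proof.
case: z => a b; case: w => c e; rewrite /sqn /= -subr_ge0.
suff -> : 2 * (a ^+ 2 + b ^+ 2) + 2 * (c ^+ 2 + e ^+ 2) - ((a + c) ^+ 2 + (b + e) ^+ 2)
  = (a - c) ^+ 2 + (b - e) ^+ 2 by rewrite addr_ge0 // sqr_ge0.
by ring.
Qed.

(** The factor is crude, but the number of summands will be fixed before the precision of the phases
    is chosen. *)
Lemma sqn_sum_le (J : Type) (s : seq J) (F : J -> R[i]) :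
  sqn (\sum_(j <- s) F j) <= 2 ^+ size s * \sum_(j <- s) sqn (F j).
Proof.
elim: s => [|j s IH]; first by rewrite !big_nil sqn0 mulr0.
rewrite !big_cons; apply: le_trans (sqnD_le _ _) _; rewrite /= exprS [leRHS]mulrDr lerD //.
  by rewrite -mulrA ler_wpM2l // -[leLHS]mul1r ler_wpM2r ?sqn_ge0 // exprn_ege1 // ler1n.
by rewrite -mulrA ler_wpM2l.
Qed.

Lemma expiD (s t : R) : expi (s + t) = expi s * expi t.
Proof. by rewrite /expi cosD sinD; apply/eqP; rewrite eq_complex /=; apply/andP; split; apply/eqP; ring. Qed.

Lemma sqn_expi (t : R) : sqn (expi t) = 1.
Proof. by rewrite /sqn /= cos2Dsin2. Qed.

End Complex.

Section ComplexMeasurable.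
Variables (disp : measure_display) (T : measurableType disp) (R : realType).
Implicit Types f g : T -> R[i].

Definition complex_measurable f :=
  measurable_fun setT (fun x => complex.Re (f x)) /\ measurable_fun setT (fun x => complex.Im (f x)).

Lemma complex_measurableD f g : complex_measurable f -> complex_measurable g ->
  complex_measurable (fun x => f x + g x).
Proof.
move=> [rf If] [rg Ig]; split.
  rewrite (_ : (fun x => _) = (fun x => complex.Re (f x)) \+ (fun x => complex.Re (g x))).
    exact: measurable_funD.
  by apply/funext => x /=; case: (f x); case: (g x).
rewrite (_ : (fun x => _) = (fun x => complex.Im (f x)) \+ (fun x => complex.Im (g x))).
  exact: measurable_funD.
by apply/funext => x /=; case: (f x); case: (g x).
Qed.

Lemma complex_measurableZ (c : R[i]) f : complex_measurable f ->
  complex_measurable (fun x => c * f x).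
Proof.
move=> [rf If]; case: c => a b; split.
  rewrite (_ : (fun x => _) = (cst a \* (fun x => complex.Re (f x))) \+
      (cst (- b) \* (fun x => complex.Im (f x)))).
    by apply: measurable_funD; apply: measurable_funM.
  by apply/funext => x /=; case: (f x) => u v /=; ring.
rewrite (_ : (fun x => _) = (cst a \* (fun x => complex.Im (f x))) \+
    (cst b \* (fun x => complex.Re (f x)))).
  by apply: measurable_funD; apply: measurable_funM.
by apply/funext => x /=; case: (f x) => u v /=; ring.
Qed.

Lemma complex_measurable_sum (J : Type) (s : seq J) (c : J -> R[i]) (F : J -> T -> R[i]) :
  (forall j, complex_measurable (F j)) ->
  complex_measurable (fun x => \sum_(j <- s) c j * F j x).
Proof.
move=> mF; elim: s => [|j s IH].
  by split; rewrite (_ : (fun x => _) = cst 0) //; apply/funext => x; rewrite big_nil.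
have := complex_measurableD (complex_measurableZ (c j) (mF j)) IH.
by rewrite (_ : (fun x => \sum_(j <- j :: s) _) = (fun x => c j * F j x + \sum_(j <- s) c j * F j x)) //;
  apply/funext => x; rewrite big_cons.
Qed.

Lemma sqn_measurable f : complex_measurable f -> measurable_fun setT (fun x => sqn (f x)).
Proof. by move=> [rf If]; apply: measurable_funD; exact: measurable_funX. Qed.

End ComplexMeasurable.

(** * Supertiles of a self-affine tiling *)

Section SelfAffine.
Variables (R : realType) (d : nat) (Lab : finType) (I : finType)
  (proto : I -> tile R d Lab) (omega : I -> seq (I * 'rV[R]_d))
  (n : nat) (Tl : set (tile R d Lab)).
Hypotheses (n1 : (1 < n)%N) (rule : subst_rule proto n%:R%:M omega)
  (prim : primitive omega) (Tlsa : self_affine proto n%:R%:M omega Tl).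
Local Notation vec := 'rV[R]_d.
Local Notation q k := (n%:R ^+ k : R).
Local Notation supertile k T := (iter k (subst proto n%:R%:M omega) [set T]).

Let n0 : 0 < n%:R :> R. Proof. by rewrite ltr0n ltnW. Qed.

Lemma q_gt0 k : 0 < q k. Proof. exact: exprn_gt0. Qed.

Lemma proto_tile i : is_tile (proto i). Proof. exact: rule.1. Qed.

Lemma tile_form T : Tl T -> exists i x, T = tr (proto i) x. Proof. exact: Tlsa.2.1. Qed.

Lemma tile_regular T y e : Tl T -> T.1 y -> 0 < e ->
  exists y' e', [/\ 0 < e', contains_ball T y' e' & forall z, `|z - y'| < e' -> `|z - y| < e].
Proof.
move=> /tile_form[i [x ->]] Ty e0; exact: (is_tile_tr (proto_tile i) Ty).
Qed.

Lemma tile_disjoint T T' y e : Tl T -> Tl T' -> 0 < e ->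
  contains_ball T y e -> contains_ball T' y e -> T = T'.
Proof.
move=> TlT TlT' e0 Ty T'y; have [[_ dis] _] := Tlsa.1.
apply/not_notP => /(dis _ _ TlT TlT') => /seteqP[/(_ y) h _].
by apply: h; split; apply/interiorP; exists e.
Qed.

Lemma tile_cover y : exists2 T, Tl T & T.1 y.
Proof. by have [_ /seteqP[_ /(_ y)]] := Tlsa.1 => /(_ Logic.I)[T TlT Ty]; exists T. Qed.

Lemma tr_proto_inj i j x y : tr (proto i) x = tr (proto j) y -> i = j /\ x = y.
Proof.
move=> E; have ij : i = j.
  by apply: (rule.2.1 i j (y - x)); rewrite -(trK (proto i) x) E tr_add.
by split => //; move: E; rewrite ij => /(tr_tile_inj (proto_tile j)).
Qed.

Lemma proto_bounded : exists2 rho : R, 0 <= rho & forall i y, (proto i).1 y -> `|y| <= rho.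
Proof.
have bd i : exists M : R, forall y, (proto i).1 y -> `|y| <= M.
  have [/compact_bounded[M [_ /(_ (M + 1))Mb]] _] := proto_tile i.
  by exists (M + 1); apply: Mb; rewrite ltrDl.
pose M i := projT1 (cid (bd i)).
exists (\sum_i `|M i|) => [|i y /(projT2 (cid (bd i)))/le_trans]; first exact: sumr_ge0.
apply; rewrite -/(M i) (bigD1 i) //= (le_trans (ler_norm _)) // lerDl.
exact: sumr_ge0.
Qed.

Lemma subst_tileE i x : subst_tile proto n%:R%:M omega (tr (proto i) x) =
  [set T' | exists2 p, p \in omega i & T' = tr (proto p.1) (p.2 + n%:R *: x)].
Proof.
apply/seteqP; split=> T' /=.
  by move=> [j [y [/tr_proto_inj[-> ->] [p pj ->]]]]; exists p; rewrite ?mul_mx_scalar.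
by move=> [p pi ->]; exists i, x; split => //; exists p; rewrite ?mul_mx_scalar.
Qed.

Lemma supertileS k T T' : supertile k.+1 T T' <->
  exists2 S, supertile k T S & subst_tile proto n%:R%:M omega S T'.
Proof. by split=> -[S h1 h2]; exists S. Qed.

Lemma supertile_form k i x T' : supertile k (tr (proto i) x) T' ->
  exists j y, T' = tr (proto j) y.
Proof.
elim: k T' => [|k IH] T'; first by move=> ->; exists i, x.
move=> /supertileS[S /IH[j [y ->]]]; rewrite subst_tileE => -[p _ ->].
by exists p.1, (p.2 + n%:R *: y).
Qed.

Lemma supertile_sub k T : Tl T -> supertile k T `<=` Tl.
Proof.
move=> TlT; elim: k => [T' -> //|k IH] T' /supertileS[S /IH TlS ST'].
by rewrite -Tlsa.2.2.1; exists S.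
Qed.

Lemma supertile_cover k T' : Tl T' -> exists2 T, Tl T & supertile k T T'.
Proof.
elim: k T' => [|k IH] T' TlT'; first by exists T'.
have : subst proto n%:R%:M omega Tl T' by rewrite Tlsa.2.2.1.
move=> [S /IH[T TlT TS] ST']; exists T => //; apply/supertileS; by exists S.
Qed.

Lemma supertile_add k l T S T' : supertile k T S -> supertile l S T' -> supertile (l + k) T T'.
Proof.
move=> TS; elim: l T' => [T' -> //|l IH] T' /supertileS[S' /IH TS' S'T'].
by rewrite addSn; apply/supertileS; exists S'.
Qed.

Lemma supertile_tr k T T' x : supertile k T T' -> supertile k (tr T x) (tr T' (q k *: x)).
Proof.
elim: k T' => [|k IH] T'; first by move=> -> /=; rewrite scale1r.
move=> /supertileS[S /IH TS [i [y [SE [p pi ->]]]]]; apply/supertileS.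
exists (tr S (q k *: x)) => //; exists i, (y + q k *: x); split; first by rewrite SE tr_add.
exists p => //; rewrite tr_add; congr tr.
by rewrite mulmxDl !mul_mx_scalar scalerA -exprS addrA.
Qed.

Lemma subst_tile_supp i x : \bigcup_(T' in subst_tile proto n%:R%:M omega (tr (proto i) x)) T'.1
  = [set n%:R *: y | y in (tr (proto i) x).1].
Proof.
have [_ [_ [_ [_ [_ supp]]]]] := rule.
have {}supp y : (exists2 p, p \in omega i & (tr (proto p.1) p.2).1 y) <->
    exists2 z, (proto i).1 z & n%:R *: z = y.
  have /seteqP[s1 s2] := supp i; split.
    move=> [p pi py]; have [|z pz zE] := s1 y; first by exists (tr (proto p.1) p.2) => //; exists p.
    by exists z; rewrite // -zE mul_mx_scalar.
  move=> [z pz zE]; have [|T [p pi ->] Ty] := s2 y; first by exists z; rewrite ?mul_mx_scalar.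
  by exists p.
rewrite subst_tileE; apply/seteqP; split=> y.
  move=> [_ [p pi ->]]; rewrite -tr_add trE => py.
  have [|z pz zE] := (supp (y - n%:R *: x)).1; first by exists p.
  exists (z + x); first by rewrite trE addrK.
  by rewrite scalerDr zE subrK.
move=> [z]; rewrite trE => pz <-.
have [|p pi py] := (supp (n%:R *: (z - x))).2; first by exists (z - x).
exists (tr (proto p.1) (p.2 + n%:R *: x)); first by exists p.
by rewrite -tr_add trE -scalerBr.
Qed.

Lemma supertile_supp k i x T' y : supertile k (tr (proto i) x) T' -> T'.1 y ->
  exists2 z, (tr (proto i) x).1 z & y = q k *: z.
Proof.
elim: k T' y => [|k IH] T' y; first by move=> -> ?; exists y; rewrite ?scale1r.
move=> /supertileS[S TS ST'] T'y; have [j [u SE]] := supertile_form TS.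
have : [set n%:R *: y | y in (tr (proto j) u).1] y.
  by rewrite -subst_tile_supp -SE; exists T'.
move=> [z Sz <-]; rewrite -SE in Sz; have [w Tw ->] := IH _ _ TS Sz.
by exists w => //; rewrite scalerA -exprS.
Qed.

Lemma supertile_nonempty k i x : exists T', supertile k (tr (proto i) x) T'.
Proof.
elim: k => [|k [S TS]]; first by exists (tr (proto i) x).
have [j [u SE]] := supertile_form TS.
have [_ [_ [p pj]]] := proto_tile j.
have : [set n%:R *: y | y in (tr (proto j) u).1] (n%:R *: (p + u)).
  by exists (p + u) => //; rewrite trE addrK.
by rewrite -subst_tile_supp -SE => -[T' ST' _]; exists T'; apply/supertileS; exists S.
Qed.

Lemma scale_q_lt k (z y : vec) e : `|z - y| < e <-> `|q k *: z - q k *: y| < q k * e.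
Proof. by rewrite -scalerBr normrZ gtr0_norm ?q_gt0 // ltr_pM2l ?q_gt0. Qed.

Lemma scale_qK k (z : vec) : q k *: ((q k)^-1 *: z) = z.
Proof. by rewrite scalerA divff ?scale1r // gt_eqF ?q_gt0. Qed.

(** [T'] lies in the [k]-th supertile of some tile [T'']. Close to [z] it contains a ball, which
    scaled down by q^k lies in both [T] and [T'']; tiles of the tiling sharing a ball coincide. *)
Lemma mem_supertile k T T' y e z : Tl T -> Tl T' -> contains_ball T y e ->
  T'.1 z -> `|z - q k *: y| < q k * e -> supertile k T T'.
Proof.
move=> TlT TlT' Ty T'z zy.
have e0 : 0 < q k * e - `|z - q k *: y| by rewrite subr_gt0.
have [y' [e' [e'0 T'y' y'z]]] := tile_regular TlT' T'z e0.
have [T'' TlT'' T''T'] := supertile_cover k TlT'.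
suff -> : T = T'' by [].
have e'q : 0 < e' / q k by rewrite divr_gt0 ?q_gt0.
apply: (tile_disjoint (y := (q k)^-1 *: y') TlT TlT'' e'q) => w.
  rewrite (scale_q_lt k) scale_qK mulrC divfK ?gt_eqF ?q_gt0 // => /y'z wz.
  apply: Ty; rewrite (scale_q_lt k).
  have -> : q k *: w - q k *: y = (q k *: w - z) + (z - q k *: y) by rewrite addrA subrK.
  by apply: le_lt_trans (ler_normD _ _) _; rewrite -ltrBrDr.
rewrite (scale_q_lt k) scale_qK mulrC divfK ?gt_eqF ?q_gt0 // => /T'y' T'w.
have [i [x T''E]] := tile_form TlT''.
rewrite T''E in T''T' *; have [v Tv /eqP] := supertile_supp T''T' T'w.
by rewrite (inj_eq (scalerI _)) ?gt_eqF ?q_gt0 // => /eqP ->.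
Qed.

(** Repetitivity with a closed ball as window; [R1] bounds the compact set of return places, and
    equality of patches becomes an equivalence tile by tile. *)
Lemma repetitive_tr (r : R) : exists R1 : R, forall x y : vec, exists2 t : vec,
  `|x + t - y| <= R1 &
  forall T, (exists2 z, T.1 z & `|z - x| <= r) -> (Tl T <-> Tl (tr T t)).
Proof.
have [_ [_ [_ [_ rep]]]] := Tlsa.
have [F [/compact_bounded[M [_ /(_ (M + 1))Mb]] repF]] := rep _ (@compact_cball0 R d r).
exists (M + 1) => x y; have [z [Fz zE]] := repF x y.
exists (y + z - x).
  have -> : x + (y + z - x) - y = z by apply/rowP => j; rewrite !mxE; ring.
  by apply: Mb => //; rewrite ltrDl.
have shiftK u v : shift [set y : vec | `|y| <= r] u v <-> `|v - u| <= r by rewrite in_shift.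
move=> T [w Tw wx]; split=> TlT.
  have : sqcap Tl (shift [set y : vec | `|y| <= r] x) T.
    by split => //; exists w; split => //; apply/shiftK.
  by rewrite zE ptrE => -[]; rewrite opprB.
suff : sqcap Tl (shift [set y : vec | `|y| <= r] x) T by case.
rewrite zE ptrE opprB; split => //; exists (w + (y + z - x)); split.
  by rewrite trE addrK.
apply/shiftK; have -> : w + (y + z - x) - (y + z) = w - x.
  by apply/rowP => j; rewrite !mxE; ring.
by [].
Qed.

(** A prototile contains a ball of some radius [e], and two of its translates less than e / 2 apart
    share a ball, hence coincide. *)
Lemma pos_discrete : exists2 delta : R, 0 < delta & forall i (x y : vec),
  Tl (tr (proto i) x) -> Tl (tr (proto i) y) -> `|x - y| < delta -> x = y.
Proof.
have each i : exists2 delta : R, 0 < delta & forall x y : vec,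
  Tl (tr (proto i) x) -> Tl (tr (proto i) y) -> `|x - y| < delta -> x = y.
  have [_ [_ [p pi]]] := proto_tile i.
  have := is_tile_tr (x := 0) (proto_tile i); rewrite tr0 => /(_ _ pi 1 ltr01)[c [e [e0 ce _]]].
  exists (e / 2) => [|x y Tx Ty xy]; first by rewrite divr_gt0.
  suff : tr (proto i) x = tr (proto i) y by move=> /tr_proto_inj[].
  apply: (tile_disjoint (y := c + x) (e := e / 2) Tx Ty) => [|w wc|w wc]; first by rewrite divr_gt0.
    rewrite trE; apply: ce; have -> : w - x - c = w - (c + x).
      by apply/rowP => j; rewrite !mxE; ring.
    by move: wc; have := divr_gt0 e0 (ltr0n R 2); lra.
  rewrite trE; apply: ce; have -> : w - y - c = (w - (c + x)) + (x - y).
    by apply/rowP => j; rewrite !mxE; ring.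
  by apply: le_lt_trans (ler_normD _ _) _; lra.
pose D i := projT1 (cid2 (each i)).
have D0 i : 0 < D i by rewrite /D; case: cid2.
exists (\big[Num.min/1]_i D i) => [|i x y Tx Ty xy].
  by apply/bigmin_gtP; split => // i _; exact: D0.
have /(_ x y Tx Ty) : forall x y : vec,
  Tl (tr (proto i) x) -> Tl (tr (proto i) y) -> `|x - y| < D i -> x = y by rewrite /D; case: cid2.
by apply; apply: lt_le_trans xy _; exact: bigmin_le_cond.
Qed.

Lemma subst_matrix_mem a b :
  (0 < subst_matrix omega a b) = has (fun p => p.1 == enum_val a) (omega (enum_val b)).
Proof. by rewrite mxE ltz_nat -has_count. Qed.

(** Entries are nonnegative, so a positive entry of a power comes from a positive term, that is from
    a chain of substitutions. *)
Lemma subst_matrix_exp_mem k a b : 0 < (subst_matrix omega ^+ k) a b ->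
  exists y, supertile k (proto (enum_val b)) (tr (proto (enum_val a)) y).
Proof.
have M0 (A B : 'I_#|I|) : 0 <= subst_matrix omega A B by rewrite mxE.
have Mk0 l : forall (A B : 'I_#|I|), 0 <= (subst_matrix omega ^+ l) A B.
  elim: l => [|l IH] A B; first by rewrite expr0 mxE; case: (_ == _).
  by rewrite exprS mxE sumr_ge0 // => c _; rewrite mulr_ge0.
elim: k a => [|k IH] a.
  by rewrite expr0 mxE; case: eqP => [->|//] _; exists 0; rewrite tr0.
rewrite exprS mxE => pos.
have [c c0] : exists c, 0 < subst_matrix omega a c * (subst_matrix omega ^+ k) c b.
  apply/existsP; rewrite -[[exists _, _]]negbK negb_exists; apply/negP => /forallP np.
  move: pos; rewrite ltNge => /negP; apply; apply: sumr_le0 => c _.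
  by rewrite leNgt; exact: np.
have Mac : 0 < subst_matrix omega a c.
  by rewrite lt_neqAle M0 andbT; apply: contraTneq c0 => <-; rewrite mul0r ltxx.
have Mcb : 0 < (subst_matrix omega ^+ k) c b.
  by rewrite lt_neqAle Mk0 andbT; apply: contraTneq c0 => <-; rewrite mulr0 ltxx.
have [y yk] := IH _ Mcb; move: Mac; rewrite subst_matrix_mem => /hasP[p pc /eqP pa].
exists (p.2 + n%:R *: y); apply/supertileS.
by exists (tr (proto (enum_val c)) y) => //; rewrite subst_tileE; exists p; rewrite ?pa.
Qed.

(** Fixes a reference type [i0] found in every [k]-th supertile. Its positions will be relatively
    dense and stable under x -> b i0 + q^k x. *)
Lemma primitive_supertile : exists (k : nat) (i0 : I) (b : I -> vec), (0 < k)%N /\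
  forall j x, supertile k (tr (proto j) x) (tr (proto i0) (b j + q k *: x)).
Proof.
have [T TlT _] := tile_cover 0; have [i0 _] := tile_form TlT.
have [k [k0 kpos]] := prim.
have ex j : exists y, supertile k (proto j) (tr (proto i0) y).
  have := kpos (enum_rank i0) (enum_rank j) => /subst_matrix_exp_mem.
  by rewrite !enum_rankK.
exists k, i0, (fun j => projT1 (cid (ex j))); split => // j x.
by rewrite -tr_add; apply: supertile_tr; exact: projT2 (cid (ex j)).
Qed.

(** * Positions of the tiles of the reference type *)

Variables (p : nat) (i0 : I) (b : I -> vec).
Hypotheses (p0 : (0 < p)%N)
  (pP : forall j x, supertile p (tr (proto j) x) (tr (proto i0) (b j + q p *: x))).
Local Notation pos x := (Tl (tr (proto i0) x)).
Local Notation hs := (hull_space Tl).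

Definition pos_diff : set vec := [set v | exists c c', [/\ pos c, pos c' & v = c' - c]].

Lemma pos_diff_return v : pos_diff v -> return_vectors Tl v.
Proof.
by move=> [c [c' [Tc Tc' ->]]]; exists (tr (proto i0) c); rewrite tr_add addrC subrK.
Qed.

(** The [p]-th supertile of a tile covering y / q^p contains a reference tile at bounded distance
    from [y]. *)
Lemma pos_dense : exists R0 : R, forall y : vec, exists2 c, pos c & `|c - y| <= R0.
Proof.
have [rho rho0 rhoP] := proto_bounded.
exists (q p * rho + \sum_j `|b j|) => y.
have [T TlT Ty] := tile_cover ((q p)^-1 *: y).
have [j [x TE]] := tile_form TlT; rewrite TE in TlT Ty.
exists (b j + q p *: x); first exact: (supertile_sub TlT (pP j x)).
have -> : b j + q p *: x - y = b j - q p *: ((q p)^-1 *: y - x).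
  by rewrite scalerBr scale_qK //; apply/rowP => i; rewrite !mxE; ring.
apply: le_trans (ler_normB _ _) _; rewrite addrC; apply: lerD.
  rewrite normrZ gtr0_norm ?q_gt0 // ler_pM2l ?q_gt0 //.
  by apply: (rhoP j); rewrite -trE.
by rewrite (bigD1 j) //= lerDl; exact: sumr_ge0.
Qed.

Lemma pos_rep (rho : R) : exists R1 : R, forall c c' : vec, pos c -> pos c' -> `|c' - c| <= rho ->
  forall y, exists t, [/\ pos (c + t), pos (c' + t) & `|c + t - y| <= R1].
Proof.
have [r r0 rP] := proto_bounded.
have [R1 rep] := repetitive_tr (rho + r).
exists R1 => c c' Tc Tc' cc' y; have [t ty tP] := rep c y.
have [_ [_ [x0 x0P]]] := proto_tile i0.
have meets e : `|e - c| <= rho -> exists2 z, (tr (proto i0) e).1 z & `|z - c| <= rho + r.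
  move=> ec; exists (x0 + e); first by rewrite trE addrK.
  have -> : x0 + e - c = (e - c) + x0 by apply/rowP => i; rewrite !mxE; ring.
  by apply: le_trans (ler_normD _ _) _; rewrite lerD // (rP i0).
exists t; rewrite -!tr_add; split => //; last exact: (tP _ (meets _ cc')).1.
apply: (tP _ (meets _ _)).1 => //; rewrite subrr normr0.
exact: le_trans cc'.
Qed.

Lemma pos_finite (r : R) : finite_set [set x : vec | pos x /\ `|x| <= r].
Proof.
have [delta delta0 deltaP] := pos_discrete.
apply: (unif_discrete_finite delta0 (r := r)) => [x y [Tx _] [Ty _]|x []//].
exact: deltaP Tx Ty.
Qed.

(** By repetitivity every difference of norm at most [rho] already occurs near the origin, where
    there are finitely many positions. *)
Lemma pos_diff_finite (rho : R) : finite_set [set v | pos_diff v /\ `|v| <= rho].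
Proof.
have [R1 rep] := pos_rep rho.
apply: (@sub_finite_set _ _ [set y - x | x in [set x | pos x /\ `|x| <= R1] &
    y in [set x | pos x /\ `|x| <= R1 + rho]]); last first.
  by apply: finite_image2; exact: pos_finite.
move=> v [[c [c' [Tc Tc' vE]]] vr].
have [|t [Tt Tt' tR]] := rep c c' Tc Tc' _ 0; first by rewrite -vE.
exists (c + t); first by split => //; rewrite -[c + t]subr0.
have vt : c' + t - (c + t) = v by rewrite vE; apply/rowP => i; rewrite !mxE; ring.
exists (c' + t) => //; split => //.
have -> : c' + t = (c + t) + v by rewrite -vt [RHS]addrC subrK.
by apply: le_trans (ler_normD _ _) _; rewrite lerD // -[c + t]subr0.
Qed.

(* Positions are recentred at the fixed point - beta of x |-> q p *: x + b i0. *)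
Lemma return_lattice : exists (B1 B2 : 'M[R]_d) (M : nat),
  [/\ B1 \in unitmx, B2 \in unitmx,
      forall v, pos_diff v -> exists z : 'rV[int]_d, v = intmx z *m B1,
      forall z : 'rV[int]_d, exists z' : 'rV[int]_d, intmx z *m B2 = intmx z' *m B1
    & forall z : 'rV[int]_d, iter M (sumset pos_diff) pos_diff (intmx z *m B2)].
Proof.
have q1 : (1 < n ^ p)%N by rewrite -(exp1n p) ltn_exp2r.
have qE : (n ^ p)%:R = q p :> R by rewrite natrX.
have qn1 : q p - 1 != 0 by rewrite subr_eq0 -qE pnatr_eq1 gtn_eqF.
pose beta : vec := (q p - 1)^-1 *: b i0.
have betaE : q p *: beta = b i0 + beta.
  apply: (subIr beta); rewrite addrK -{2}[beta]scale1r -scalerBl.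
  by rewrite /beta scalerA divff // scale1r.
pose C := [set c | pos (c - beta)].
have DE : [set v | exists c c', [/\ C c, C c' & v = c' - c]] = pos_diff.
  apply/seteqP; split=> v [c [c' [Cc Cc' ->]]].
    exists (c - beta), (c' - beta); split => //.
    by apply/rowP => i; rewrite !mxE; ring.
  exists (c + beta), (c' + beta); rewrite /C /= !addrK; split => //.
  by apply/rowP => i; rewrite !mxE; ring.
have Cq c : C c -> C ((n ^ p)%:R *: c).
  rewrite /C /= qE => Cc; have -> : q p *: c - beta = b i0 + q p *: (c - beta).
    by rewrite scalerBr betaE; apply/rowP => i; rewrite !mxE; ring.
  exact: (supertile_sub Cc (pP i0 _)).
have [R0 dense] := pos_dense.
have Cdense y : exists2 c, C c & `|c - y| <= R0.
  have [c Cc cy] := dense (y - beta); exists (c + beta); first by rewrite /C /= addrK.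
  by have -> : c + beta - y = c - (y - beta) by apply/rowP => i; rewrite !mxE; ring.
have Crep rho : exists R1, forall c c', C c -> C c' -> `|c' - c| <= rho ->
    forall y, exists t, [/\ C (c + t), C (c' + t) & `|c + t - y| <= R1].
  have [R1 rep] := pos_rep rho; exists R1 => c c' Cc Cc' cc' y.
  have [|t [Ct Ct' tR]] := rep _ _ Cc Cc' _ (y - beta).
    by rewrite opprB addrA subrK.
  exists t; rewrite /C /= ![_ + t - beta]addrAC; split => //.
  have -> : c + t - y = c - beta + t - (y - beta).
    by apply/rowP => i; rewrite !mxE; ring.
  by [].
have := @lattice_in_sums _ _ _ C R0 q1 Cq Cdense _ Crep; rewrite DE; apply.
exact: pos_diff_finite.
Qed.

(* Equal tiles at relative position v have equal k-th supertiles at relative position q k *: v. *)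
Lemma patch_return v : pos_diff v -> exists (W : seq vec) (r0 : R), 0 < r0 /\
  forall y : vec, exists2 w, w \in W & forall k T, (exists2 z, T.1 z & `|z - q k *: (y + w)| < q k * r0) ->
    (Tl T <-> Tl (tr T (q k *: v))).
Proof.
move=> [c [c' [Tc Tc' vE]]].
have [_ [_ [x0 x0P]]] := proto_tile i0.
have T0x : (tr (proto i0) c).1 (x0 + c) by rewrite trE addrK.
have [m0 [r1 [r10 m0T _]]] := tile_regular Tc T0x ltr01.
have [R1 rep] := repetitive_tr `|v|.
have r12 : 0 < r1 / 2 by rewrite divr_gt0.
(* The recurrence place m0 + t lies within [R1] of [y]; the net approximates m0 + t - y up to r1 / 2
   and does not depend on [k]. *)
have [W WP] := finite_net d R1 r12.
exists W, (r1 / 2); split => // y; have [t ty tP] := rep m0 y.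
have [w wW wt] := WP _ ty; exists w => // k T [z Tz zw].
have c'E : tr (proto i0) c' = tr (tr (proto i0) c) v by rewrite tr_add vE addrC subrK.
have Tct : Tl (tr (tr (proto i0) c) t).
  apply: (tP _ _).1 => //; exists m0; last by rewrite subrr normr0.
  by apply: m0T; rewrite subrr normr0.
have Tct' : Tl (tr (tr (tr (proto i0) c) t) v).
  rewrite tr_add addrC -tr_add -c'E; apply: (tP _ _).1 => //.
  exists (m0 + v); last by rewrite addrC addKr.
  by rewrite c'E trE addrK; apply: m0T; rewrite subrr normr0.
have cb : contains_ball (tr (tr (proto i0) c) t) (m0 + t) r1.
  move=> u um; rewrite trE; apply: m0T.
  by have -> : u - t - m0 = u - (m0 + t) by apply/rowP => i; rewrite !mxE; ring.
have cb' : contains_ball (tr (tr (tr (proto i0) c) t) v) (m0 + t + v) r1.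
  move=> u um; rewrite trE; apply: cb.
  by have -> : u - v - (m0 + t) = u - (m0 + t + v) by apply/rowP => i; rewrite !mxE; ring.
have zm : `|z - q k *: (m0 + t)| < q k * r1.
  have -> : z - q k *: (m0 + t) = (z - q k *: (y + w)) - q k *: (m0 + t - y - w).
    by apply/rowP => i; rewrite !mxE; ring.
  apply: le_lt_trans (ler_normB _ _) _; rewrite normrZ gtr0_norm ?q_gt0 //.
  have : q k * `|m0 + t - y - w| < q k * (r1 / 2) by rewrite ltr_pM2l // q_gt0.
  by lra.
split=> TlT.
  have := supertile_tr v (mem_supertile Tct TlT cb Tz zm).
  exact: supertile_sub.
have zv : (tr T (q k *: v)).1 (z + q k *: v) by rewrite trE addrK.
have zmv : `|z + q k *: v - q k *: (m0 + t + v)| < q k * r1.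
  by rewrite scalerDr opprD addrACA subrr addr0.
have := supertile_tr (- v) (mem_supertile Tct' TlT cb' zv zmv).
by rewrite trK scalerN trK; exact: supertile_sub.
Qed.

(** On a window large enough for all [w] and for the move by q^k v, [S] is the translate of [Tl] by
    some [z]. The list [W] is the same for all [k]; [k0] makes q^k r0 exceed [r]. *)
Lemma hull_patch_return v : pos_diff v -> exists W : seq vec, forall r : R, exists k0, forall k,
  (k0 <= k)%N -> forall S, hull Tl S -> exists2 w, w \in W &
    agree_on r (ptr S (- (q k *: w))) (ptr (ptr S (- (q k *: w))) (- (q k *: v))).
Proof.
move=> vD; have [W [r0 [r00 WP]]] := patch_return vD.
exists W => r; have [k0 k0P] := expn_unbounded (r / r0) n1.
exists k0 => k /k0P rk S hS.
pose B := \sum_(w <- W) `|w|.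
have WB w : w \in W -> `|w| <= B.
  move=> wW; rewrite /B (big_rem w wW) /= lerDl; exact: sumr_ge0.
have [z E] := hull_local (r + q k * (B + `|v|)) hS.
(* With y = - z / q^k, the centre q^k (y + w) in [Tl] corresponds to q^k w in [S]. *)
have [w wW wP] := WP (- ((q k)^-1 *: z)); exists w => // T [x Tx xr].
have qw : `|q k *: w| <= q k * B.
  by rewrite normrZ gtr0_norm ?q_gt0 // ler_pM2l ?q_gt0 // WB.
have qv : `|q k *: v| = q k * `|v| by rewrite normrZ gtr0_norm ?q_gt0.
have v0 : 0 <= q k * `|v| by rewrite -qv.
have E1 : S (tr T (q k *: w)) <-> Tl (tr T (q k *: w - z)).
  rewrite -tr_add -[Tl _]ptrE; apply: E; exists (x + q k *: w); first by rewrite trE addrK.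
  by apply: le_lt_trans (ler_normD _ _) _; rewrite mulrDr; lra.
have E2 : S (tr T (q k *: v + q k *: w)) <-> Tl (tr (tr T (q k *: w - z)) (q k *: v)).
  rewrite tr_add [_ - z + _]addrAC [q k *: w + _]addrC -[tr T (_ - z)]tr_add -[Tl _]ptrE.
  apply: E; exists (x + (q k *: v + q k *: w)); first by rewrite trE addrK.
  apply: le_lt_trans (ler_normD _ _) _; have := ler_normD (q k *: v) (q k *: w).
  by rewrite mulrDr; lra.
have E3 : Tl (tr T (q k *: w - z)) <-> Tl (tr (tr T (q k *: w - z)) (q k *: v)).
  apply: wP; exists (x + (q k *: w - z)); first by rewrite trE addrK.
  have -> : x + (q k *: w - z) - q k *: (- ((q k)^-1 *: z) + w) = x.
    by rewrite scalerDr scalerN scale_qK //; apply/rowP => i; rewrite !mxE; ring.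
  by apply: lt_le_trans xr _; move: rk; rewrite ltr_pdivrMr // => /ltW.
rewrite !ptrE !opprK tr_add; split; first by move=> /E1/E3/E2.
by move=> /E2/E3/E1.
Qed.

(** * Eigenvalues *)

Section Spectral.
Variable mu : probability hs R.
Hypothesis mu_inv : translation_invariant_prob mu.
Local Notation pr := (pr mu).
Local Notation back x A := ((fun S : hs => ptr S (- x)) @^-1` A).

Lemma back_measurable (x : vec) (A : set hs) : measurable A -> measurable (back x A).
Proof. by move=> mA; have := @ptr_measurable R d Lab Tl (- x) measurableT A mA; rewrite setTI. Qed.

Lemma pr_back (x : vec) (A : set hs) : measurable A -> pr (back x A) = pr A.
Proof. by move=> mA; apply: pr_congr; rewrite mu_inv.2. Qed.

Lemma pr_hull : pr (hull Tl) = 1.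
Proof. by have := prE mu (@hull_measurable _ _ _ Tl); rewrite mu_inv.1 => -[]. Qed.

Lemma pr_setI_hull (A : set hs) : measurable A -> pr (A `&` hull Tl) = pr A.
Proof.
move=> mA; have mh := @hull_measurable _ _ _ Tl; have mAh := measurableI _ _ mA mh.
apply/eqP; rewrite eq_le; apply/andP; split; first by apply: pr_le => // S [].
have : pr A <= pr ((A `&` hull Tl) `|` ~` hull Tl).
  apply: pr_le => //; first by apply: measurableU => //; exact: measurableC.
  by move=> S AS; have [?|?] := pselect (hull Tl S); [left|right].
have := pr_setU mu mAh (measurableC mh); rewrite pr_setC // pr_hull; lra.
Qed.

Definition eigenvalue (a : vec) := exists f : hs -> R[i],
  [/\ L2 mu f, (forall x : vec, {ae mu, forall S, f (ptr S (- x)) = expi (2 * pi * dotv x a) * f S})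
    & (\int[mu]_S (sqn (f S))%:E = 1)%E].

(** Convergence to 1 of the phases by which the translations q^k x multiply an eigenfunction with
    eigenvalue [a]. *)
Definition phase_null (a x : vec) := forall eta : R, 0 < eta -> exists k0, forall k, (k0 <= k)%N ->
  sqn (expi (2 * pi * dotv (q k *: x) a) - 1) < eta.

Lemma phase_nullD a x y : phase_null a x -> phase_null a y -> phase_null a (x + y).
Proof.
move=> nx ny eta eta0; have e4 : 0 < eta / 4 by rewrite divr_gt0.
have [k0 k0P] := nx _ e4; have [k1 k1P] := ny _ e4.
exists (maxn k0 k1) => k; rewrite geq_max => /andP[kk0 kk1].
rewrite scalerDr dotvDl mulrDr expiD.
set u := expi _; set v := expi _.
have -> : u * v - 1 = (u - 1) * v + (v - 1) by rewrite mulrBl mul1r addrA subrK.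
apply: le_lt_trans (sqnD_le _ _) _; rewrite sqnM sqn_expi mulr1.
by have := k0P k kk0; have := k1P k kk1; rewrite -/u -/v; lra.
Qed.

(** Otherwise [f] would vanish off a countable union of null sets and have norm 0. *)
Lemma eigenfunction_nontrivial (f : hs -> R[i]) : L2 mu f -> (\int[mu]_S (sqn (f S))%:E = 1)%E ->
  exists m : nat, 0 < pr [set S | m.+1%:R^-1 <= sqn (f S)].
Proof.
move=> [rf [If _]] int1; apply/not_existsP => np.
have msq : measurable_fun setT (fun S => sqn (f S)) by exact: sqn_measurable.
have mF m : measurable [set S | m.+1%:R^-1 <= sqn (f S)] by exact: measurable_ge.
have null m : mu.-negligible [set S | m.+1%:R^-1 <= sqn (f S)].
  apply/negligibleP => //; rewrite [LHS](prE mu (mF m)); congr _%:E; apply/eqP.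
  by rewrite eq_le pr_ge0 andbT leNgt; apply/negP; exact: np.
have := negligible_bigcup null => nullU.
have : (\int[mu]_S (sqn (f S))%:E = \int[mu]_S (cst 0 S))%E.
  apply: ae_eq_integral => //; first exact/measurable_EFinP.
  apply: (negligibleS _ nullU) => S /= nS; apply: contrapT => nU; apply: nS => _.
  congr _%:E; apply/eqP; rewrite eq_le sqn_ge0 andbT leNgt; apply/negP => s0; apply: nU.
  exists (Num.truncn (sqn (f S))^-1) => //=.
  by rewrite invf_ple ?posrE // ltW // truncnS_gt.
by rewrite int1 integral0 => /eqP; rewrite eqe oner_eq0.
Qed.

(* f is nearly constant along returns of large patches, whereas it is multiplied by the phase. *)
Lemma eigenvalue_phase_null a v : eigenvalue a -> pos_diff v -> phase_null a v.
Proof.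
move=> [f [Lf eig int1]] vD eta eta0; apply: contrapT => nconv.
have [rf [If _]] := Lf.
have [m Fm0] := eigenfunction_nontrivial Lf int1.
set F := [set S | _] in Fm0.
have mF : measurable F by apply: measurable_ge; exact: sqn_measurable.
have [W WP] := hull_patch_return vD.
(* Small enough that |W| bad sets, each of probability at most 4 e, cannot cover [F]. *)
pose e := pr F / (8 * ((size W)%:R + 1)).
have e0 : 0 < e by rewrite divr_gt0 // mulr_gt0 // ltr_wpDl.
(* As h <= 1, differences below [h] in real and imaginary part give a squared distance at most 2 h^2
   <= 2 h, less than eta / (m + 1). *)
pose h := Num.min 1 (eta / m.+1%:R / 4).
have h0 : 0 < h by rewrite lt_min ltr01 /= !divr_gt0.
have [r1 [D1 [mD1 D1lt D1P]]] := measurable_locally_close mu rf e0 h0.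
have [r2 [D2 [mD2 D2lt D2P]]] := measurable_locally_close mu If e0 h0.
pose D := D1 `|` D2.
have mD : measurable D by exact: measurableU.
have Dlt : pr D < 2 * e by have := pr_setU mu mD1 mD2; rewrite -/D; lra.
have [k0 k0P] := WP (Num.max r1 r2).
have [k [k0k ek]] : exists k, (k0 <= k)%N /\ eta <= sqn (expi (2 * pi * dotv (q k *: v) a) - 1).
  apply: contrapT => np; apply: nconv; exists k0 => k k0k; rewrite ltNge; apply/negP => le.
  by apply: np; exists k.
pose N x := projT1 (cid (pr_ae_null (eig x))).
have NP x : [/\ measurable (N x), pr (N x) = 0 & forall S, ~ N x S ->
  f (ptr S (- x)) = expi (2 * pi * dotv x a) * f S] := projT2 (cid (pr_ae_null (eig x))).
have mN x : measurable (N x) by case: (NP x).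
have N0 x : pr (N x) = 0 by case: (NP x).
pose Bad w := N (q k *: w) `|` back (q k *: w) ((N (q k *: v) `|` D) `|` back (q k *: v) D).
have mND : measurable (N (q k *: v) `|` D) by exact: measurableU.
have mB : measurable ((N (q k *: v) `|` D) `|` back (q k *: v) D).
  by apply: measurableU => //; exact: back_measurable.
have mBad w : measurable (Bad w) by apply: measurableU => //; exact: back_measurable.
have Badle w : pr (Bad w) <= 4 * e.
  have := pr_setU mu (mN (q k *: w)) (back_measurable (q k *: w) mB); rewrite -/(Bad w) N0 pr_back //.
  have := pr_setU mu mND (back_measurable (q k *: v) mD); rewrite pr_back //.
  have := pr_setU mu (mN (q k *: v)) mD; rewrite N0; lra.
have mFh : measurable (F `&` hull Tl) by apply: measurableI => //; exact: hull_measurable.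
have := pr_cover (mu := mu) (W := W) mFh mBad Badle; rewrite pr_setI_hull //.
have contra : (size W)%:R * (4 * e) < pr F.
  have -> : pr F = ((size W)%:R + 1) * (8 * e) by rewrite /e; field; rewrite gt_eqF // ltr_wpDl.
  have : 0 <= (size W)%:R * e by rewrite mulr_ge0 // ltW.
  by lra.
move=> cov; move: contra; rewrite ltNge => /negP; apply; apply: cov => S [FS hS].
have [w wW E] := k0P k k0k S hS; exists w => //; apply: contrapT.
set S1 := ptr S (- (q k *: w)) in E *; set S2 := ptr S1 (- (q k *: v)) in E.
move=> /not_orP[nNw /not_orP[/not_orP[nNv nD1] nD2]].
have f1 : f S1 = expi (2 * pi * dotv (q k *: w) a) * f S by case: (NP (q k *: w)) => _ _; apply.
have f2 : f S2 = expi (2 * pi * dotv (q k *: v) a) * f S1 by case: (NP (q k *: v)) => _ _; apply.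
have hS1 : hull Tl S1 by exact: hull_ptr.
have hS2 : hull Tl S2 by exact: hull_ptr.
move/not_orP: nD1 => [nD11 nD12]; move/not_orP: nD2 => [nD21 nD22].
have c1 : `|complex.Re (f S1) - complex.Re (f S2)| < h.
  by apply: D1P => //; apply: agree_on_le E; rewrite le_max lexx.
have c2 : `|complex.Im (f S1) - complex.Im (f S2)| < h.
  by apply: D2P => //; apply: agree_on_le E; rewrite le_max lexx orbT.
(* A phase far from 1 moves f(S1), whose modulus is that of f(S), by a definite amount. *)
have far : eta / m.+1%:R <= sqn (f S1 - f S2).
  have -> : f S1 - f S2 = - ((expi (2 * pi * dotv (q k *: v) a) - 1) * f S1).
    by rewrite f2 mulrBl mul1r opprB.
  rewrite sqnN sqnM f1 sqnM sqn_expi mul1r; by apply: ler_pM => //; exact: ltW.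
have near : sqn (f S1 - f S2) <= h ^+ 2 + h ^+ 2.
  have -> : sqn (f S1 - f S2) = `|complex.Re (f S1) - complex.Re (f S2)| ^+ 2
      + `|complex.Im (f S1) - complex.Im (f S2)| ^+ 2.
    by rewrite !real_normK ?num_real // /sqn; case: (f S1); case: (f S2).
  by apply: lerD; rewrite ler_sqr ?nnegrE ?(ltW h0) // ltW.
have hh : h ^+ 2 <= h by rewrite expr2 -[leRHS]mulr1 ler_wpM2l ?(ltW h0) // /h ge_min lexx.
have h4 : h <= eta / m.+1%:R / 4 by rewrite /h ge_min lexx orbT.
have : 0 < eta / m.+1%:R by rewrite divr_gt0.
by move: far h4; move: (eta / m.+1%:R) => X; lra.
Qed.

Lemma eigenvalue_phase_null_sum a M x : eigenvalue a ->
  iter M (sumset pos_diff) pos_diff x -> phase_null a x.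
Proof.
move=> ea; elim: M x => [|M IH] x; first exact: eigenvalue_phase_null.
by move=> [u uD [w /IH nw <-]]; apply: phase_nullD => //; exact: eigenvalue_phase_null.
Qed.

(** * Almost invariance of events under the translations q^k x *)

Hypothesis pure : pure_discrete_spectrum mu.

Lemma indicator_L2 (A : set hs) : measurable A ->
  L2 mu (fun S => if S \in A then 1 else 0) .
Proof.
move=> mA; split; [|split].
- rewrite (_ : (fun S => _) = \1_A); first exact: measurable_indic.
  by apply/funext => S; rewrite indicE; case: (S \in A).
- rewrite (_ : (fun S => _) = cst 0) //.
  by apply/funext => S; case: (S \in A).
- rewrite (eq_integral (fun S => (\1_A S)%:E)) ?integral_indic // ?setIT ?(le_lt_trans (probability_le1 mu mA)) ?ltry //.
  by move=> S _; rewrite indicE; case: (S \in A); rewrite ?sqn1 ?sqn0.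
Qed.

(** The indicator [g] of [A] is approximated by a combination [G] of finitely many eigenfunctions.
    For large [k] their phases at q^k x are all close to 1, so [G] changes little outside a set of
    small probability, while [g] drops from 1 to 0 on the set to be estimated. *)
Lemma phase_null_almost_period (A : set hs) (x : vec) : measurable A ->
  (forall a, eigenvalue a -> phase_null a x) ->
  forall eps : R, 0 < eps -> exists k0, forall k, (k0 <= k)%N -> pr (A `\` back (q k *: x) A) < eps.
Proof.
move=> mA null eps eps0; have [_ [E [EP [_ Edense]]]] := pure.
pose g : hs -> R[i] := fun S => if S \in A then 1 else 0.
(* By Markov's inequality at the threshold 1/16, the approximation error [h] is large with
   probability at most eps / 4. *)
have e64 : 0 < eps / 64 by rewrite divr_gt0.
have [N [c [f [fE intlt]]]] := Edense g (indicator_L2 mA) _ e64.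
have fm j : complex_measurable (f j) by case: (EP _ (fE j)) => -[? [? _]].
pose G S := \sum_(j < N) c j * f j S.
have Gm : complex_measurable G by exact: complex_measurable_sum.
have gm : complex_measurable g by case: (indicator_L2 mA) => ? [].
pose h S := g S - G S.
have hm : complex_measurable h.
  have := complex_measurableD gm (complex_measurableZ (-1) Gm).
  by rewrite (_ : (fun S => _ + _) = h) //; apply/funext => S; rewrite mulN1r.
have hsq := sqn_measurable hm.
pose Z := [set S | 16^-1 <= sqn (h S)].
have mZ : measurable Z by exact: measurable_ge.
have Zle : pr Z <= eps / 4.
  have i16 : (0 : R) < 16^-1 by rewrite invr_gt0.
  have := pr_markov hsq (fun S => sqn_ge0 (h S)) i16 intlt.
  by have -> : eps / 64 / 16^-1 = eps / 4 by field.
pose Phi S : R := \sum_(j < N) sqn (c j) * sqn (f j S).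
have mPhi : measurable_fun setT Phi.
  apply: measurable_sum => j; apply: measurable_funM => //; exact: sqn_measurable.
have e4 : 0 < eps / 4 by rewrite divr_gt0.
have [m Philt] := pr_tail mu mPhi e4.
have mPhim := measurable_ge m%:R mPhi.
(* Where Phi < m, phases within 1 / (4 C) of 1 in squared modulus keep the change [Q] of [G] at
   squared modulus at most 1/4. *)
pose C : R := 2 ^+ N * (m%:R + 1).
have C0 : 0 < C by rewrite mulr_gt0 // ltr_wpDl.
have eta0 : 0 < (4 * C)^-1 by rewrite invr_gt0 mulr_gt0.
have [a aP] : exists a : 'I_N -> vec, forall j x, {ae mu, forall S,
    f j (ptr S (- x)) = expi (2 * pi * dotv x (a j)) * f j S}.
  have ex j : exists b, forall x, {ae mu, forall S, f j (ptr S (- x)) = expi (2 * pi * dotv x b) * f j S}.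
    by case: (EP _ (fE j)) => _ [].
  by exists (fun j => projT1 (cid (ex j))) => j; exact: projT2 (cid (ex j)).
have nulla j : phase_null (a j) x.
  by apply: null; exists (f j); case: (EP _ (fE j)) => ? [_ ?]; split => //; exact: aP.
pose K j := projT1 (cid (nulla j _ eta0)).
have KP j : forall k, (K j <= k)%N -> sqn (expi (2 * pi * dotv (q k *: x) (a j)) - 1) < (4 * C)^-1.
  exact: projT2 (cid (nulla j _ eta0)).
exists (\max_j K j) => k Kk.
have {}KP j : sqn (expi (2 * pi * dotv (q k *: x) (a j)) - 1) < (4 * C)^-1.
  by apply: KP; apply: leq_trans Kk; exact: leq_bigmax.
have aeall : {ae mu, forall S, forall j, f j (ptr S (- (q k *: x))) =
    expi (2 * pi * dotv (q k *: x) (a j)) * f j S}.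
  by apply: filter_forall => j; exact: aP.
have [Nu [mNu Nu0 NuP]] := pr_ae_null aeall.
have mbA : measurable (back (q k *: x) A) by exact: back_measurable.
have mbZ : measurable (back (q k *: x) Z) by exact: back_measurable.
have m1 : measurable (Nu `|` [set S | m%:R <= Phi S]) by exact: measurableU.
have m2 : measurable (Z `|` back (q k *: x) Z) by exact: measurableU.
apply: (@le_lt_trans _ _ (pr ((Nu `|` [set S | m%:R <= Phi S]) `|` (Z `|` back (q k *: x) Z)))).
  apply: pr_le; [exact: measurableD | exact: measurableU |].
  move=> S [AS nA]; apply: contrapT => /not_orP[/not_orP[nNu /negP nPhi] /not_orP[/negP nZ /negP nZ']].
  rewrite -ltNge in nPhi; rewrite /= -ltNge in nZ; rewrite /= -ltNge in nZ'.
  set S' := ptr S (- (q k *: x)) in nA nZ'.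
  pose Q := \sum_(j < N) c j * (expi (2 * pi * dotv (q k *: x) (a j)) - 1) * f j S.
  have GQ : G S' = G S + Q.
    rewrite /G /Q -big_split; apply: eq_bigr => j _ /=; rewrite (NuP S nNu j); ring.
  have gS : g S = 1 by rewrite /g mem_set.
  have gS' : g S' = 0 by rewrite /g memNset.
  (* The jump 1 is a difference of approximation errors, of squared modulus below 1/4, minus [Q];
     twice the sum of both squared moduli stays below 1. *)
  have one : 1 = (h S - h S') - Q by rewrite /h gS gS' GQ; ring.
  have hh : sqn (h S - h S') < 4^-1.
    apply: le_lt_trans (sqnD_le _ _) _; rewrite sqnN; lra.
  have Qle : sqn Q <= 4^-1.
    apply: le_trans (sqn_sum_le _ _) _.
    have -> : size (index_enum 'I_N) = N by rewrite /index_enum -enumT size_enum_ord.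
    apply: (@le_trans _ _ (2 ^+ N * ((4 * C)^-1 * Phi S))).
      rewrite ler_wpM2l ?exprn_ge0 // /Phi mulr_sumr; apply: ler_sum => j _.
      rewrite !sqnM mulrAC [leRHS]mulrC ler_wpM2l ?mulr_ge0 ?sqn_ge0 //.
      exact: ltW (KP j).
    have -> : 4^-1 = 2 ^+ N * ((4 * C)^-1 * (m%:R + 1)).
      by rewrite /C; field; rewrite !gt_eqF ?exprn_gt0 // ltr_wpDl.
    by rewrite ler_wpM2l ?exprn_ge0 // ler_wpM2l ?(ltW eta0) //; lra.
  have := sqnD_le (h S - h S') (- Q); rewrite -one sqn1 sqnN; lra.
have := pr_setU mu m1 m2; have := pr_setU mu mNu mPhim; have := pr_setU mu mZ mbZ.
rewrite Nu0 pr_back //; lra.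
Qed.

End Spectral.

(** * Coincidences *)

Section Coincidence.
Variables (B1 : 'M[R]_d) (B1u : B1 \in unitmx).
Hypothesis diffB1 : forall v, pos_diff v -> exists z : 'rV[int]_d, v = intmx z *m B1.

Definition near_origin (delta : R) : set hs :=
  [set S | exists2 y : vec, `|y| < delta & S (tr (proto i0) y)] `&` hull Tl.

(** The condition is open: two displacements below half of delta - |y| keep the tile within
    [delta]. *)
Lemma near_origin_measurable (delta : R) : measurable (near_origin delta).
Proof.
apply: hull_open_measurable => S [y yd Sy].
have [_ [_ [x0 x0P]]] := proto_tile i0.
have d0 : 0 < delta by apply: le_lt_trans yd.
pose e := (delta - `|y|) / 2; have e0 : 0 < e by rewrite divr_gt0 // subr_gt0.
exists (`|x0| + delta + e), e; split; first by rewrite addr_gt0 // ltr_wpDl.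
split => // S' /agreeP[u [w [ue we E]]].
have := (E (tr (proto i0) (y + u)) _).1; rewrite !ptrE !tr_add addrK => E'.
exists (y + u - w).
  have := ler_normB (y + u) w; have := ler_normD y u; rewrite /e in ue we *; lra.
apply: E' => //; exists (x0 + (y + u)); first by rewrite trE addrK.
have := ler_normD x0 (y + u); have := ler_normD y u; lra.
Qed.

(** [x], [m] and [r] are measured before the inflation by q^k. *)
Definition coincidence k (x m : vec) (r : R) := exists c, [/\ pos c, pos (c + q k *: x) &
  forall z, (tr (proto i0) c).1 z -> `|z - q k *: m| < q k * r].

(** Both tiles lie in [k]-th supertiles of tiles close to m + t. These tiles recur moved by - t, and
    the supertiles of the copies contain the two tiles moved by - q^k t. *)
Lemma coincidence_translate k (x m t : vec) (r : R) :
  (forall T, (exists2 z, T.1 z & `|z - m| <= r + `|x|) -> Tl (tr T t) -> Tl T) ->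
  coincidence k x (m + t) r -> coincidence k x m r.
Proof.
move=> tP [c [Tc Tcx cin]].
have back (e : vec) : pos e -> (exists2 z, (tr (proto i0) e).1 z &
    `|z - q k *: (m + t)| <= q k * (r + `|x|)) -> pos (e - q k *: t).
  move=> Te [z ez zr].
  have [T TlT Te'] := supertile_cover k Te.
  have [j [u TE]] := tile_form TlT.
  rewrite TE in Te' TlT; have [y Ty zE] := supertile_supp Te' ez.
  have : Tl (tr (tr (proto j) u) (- t)).
    apply: tP; last by rewrite tr_add addNr tr0.
    exists (y - t); first by rewrite trE opprK subrK.
    have : `|q k *: (y - t - m)| <= q k * (r + `|x|).
      by have -> : q k *: (y - t - m) = z - q k *: (m + t) by
        rewrite zE; apply/rowP => i; rewrite !mxE; ring.
    by rewrite normrZ gtr0_norm ?q_gt0 // ler_pM2l ?q_gt0.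
  move=> /(supertile_sub (k := k)); rewrite -scalerN -tr_add; apply.
  exact: supertile_tr.
have [_ [_ [x0 x0P]]] := proto_tile i0.
have cx0 : (tr (proto i0) c).1 (x0 + c) by rewrite trE addrK.
have cin0 := cin _ cx0.
exists (c - q k *: t); split.
- apply: back => //; exists (x0 + c) => //; apply: ltW; apply: lt_le_trans cin0 _.
  by rewrite ler_pM2l ?q_gt0 // lerDl.
- rewrite addrAC; apply: back => //; exists (x0 + c + q k *: x).
    by rewrite trE opprD addrA addrAC addrK addrK.
  rewrite addrAC; apply: le_trans (ler_normD _ _) _.
  by rewrite normrZ (gtr0_norm (q_gt0 k)) mulrDr lerD2r ltW.
- move=> z; rewrite trE => cz.
  have := cin (z + q k *: t); rewrite trE.
  have -> : z + q k *: t - c = z - (c - q k *: t) by apply/rowP => i; rewrite !mxE; ring.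
  have -> : z + q k *: t - q k *: (m + t) = z - q k *: m by apply/rowP => i; rewrite !mxE; ring.
  exact.
Qed.

(** By repetitivity the surroundings of [m] recur near every place, with no coincidence over the
    copies either: so some position [c] near q^k (y + w) has no partner at c + q^k x. A translation
    bringing this position near the origin puts [S] into the exceptional set; the number of
    translations tried does not depend on [k]. *)
Lemma no_coincidence_cover (x m : vec) (r delta : R) : 0 < r -> 0 < delta ->
  (exists z : 'rV[int]_d, x = intmx z *m B1) ->
  (forall z : 'rV[int]_d, `|intmx z *m B1| < delta + delta -> z = 0) ->
  exists (W : seq (vec * vec)) (k1 : nat), forall k, (k1 <= k)%N -> ~ coincidence k x m r ->
    forall S, hull Tl S -> exists2 w, w \in W &
      (near_origin delta `\` ((fun S : hs => ptr S (- (q k *: x))) @^-1` near_origin delta))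
        (ptr S (- (q k *: w.1 + w.2))).
Proof.
move=> r0 delta0 [zx xE] disc.
have [R1 rep] := repetitive_tr (r + `|x|).
have [rho rho0 rhoP] := proto_bounded.
have [R0 dense] := pos_dense.
have r2 : 0 < r / 2 by rewrite divr_gt0.
have [W WP] := finite_net d R1 r2.
have [V VP] := finite_net d R0 delta0.
(* For such [k] a tile at [c] fits into the ball of radius q^k r despite the errors [R0], [rho] and
   q^k r / 2. *)
have [k1 k1P] := expn_unbounded ((R0 + rho) / (r / 2)) n1.
exists [seq (w, v) | w <- W, v <- V], k1 => k /k1P k1k nco S hS.
have {}k1k : R0 + rho < q k * (r / 2) by rewrite -ltr_pdivrMr.
pose BW := \sum_(w <- W) `|w|; pose BV := \sum_(v <- V) `|v|.
have sum_le (s : seq vec) w : w \in s -> `|w| <= \sum_(w <- s) `|w|.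
  by move=> ws; rewrite (big_rem w ws) /= lerDl; exact: sumr_ge0.
have [z0 E] := hull_local (rho + delta + q k * BW + BV + q k * `|x| + 1) hS.
pose y := - ((q k)^-1 *: z0).
have qy : q k *: y = - z0 by rewrite /y scalerN scale_qK.
have [t ty tP] := rep m y.
have [w wW wt] := WP _ ty.
have [c Tc cz] := dense (q k *: (y + w)).
have [v vV cv] := VP _ cz.
exists (w, v); first by apply: allpairs_f.
have ncx : ~ pos (c + q k *: x).
  move=> Tcx; apply: nco; apply: (coincidence_translate (t := t)).
    by move=> T Tz; case: (tP T Tz).
  exists c; split => // z; rewrite trE => /rhoP zr.
  have -> : z - q k *: (m + t) = (z - c) + (c - q k *: (y + w)) - q k *: (m + t - y - w).
    by apply/rowP => i; rewrite !mxE; ring.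
  apply: le_lt_trans (ler_normB _ _) _; apply: le_lt_trans (lerD (ler_normD _ _) (lexx _)) _.
  rewrite [`|q k *: _|]normrZ gtr0_norm ?q_gt0 //.
  have : q k * `|m + t - y - w| < q k * (r / 2) by rewrite ltr_pM2l // q_gt0.
  by lra.
have qw : `|q k *: w| <= q k * BW.
  by rewrite normrZ gtr0_norm ?q_gt0 // ler_pM2l ?q_gt0 // sum_le.
have vB : `|v| <= BV by exact: sum_le.
have qx : `|q k *: x| = q k * `|x| by rewrite normrZ gtr0_norm ?q_gt0.
have qx0 : 0 <= q k * `|x| by rewrite -qx.
have [_ [_ [x0 x0P]]] := proto_tile i0.
have transfer (u : vec) : `|u - (q k *: w + v)| <= delta + q k * `|x| ->
    (S (tr (proto i0) u) <-> pos (u - z0)).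
  move=> ub; rewrite -[tr _ (u - z0)]tr_add -[Tl _]ptrE.
  apply: E; exists (x0 + u); first by rewrite trE addrK.
  have -> : x0 + u = x0 + (u - (q k *: w + v)) + (q k *: w + v).
    by apply/rowP => i; rewrite !mxE; ring.
  have := ler_normD (x0 + (u - (q k *: w + v))) (q k *: w + v).
  have := ler_normD x0 (u - (q k *: w + v)); have := ler_normD (q k *: w) v.
  have := rhoP _ _ x0P; lra.
have hS' := hull_ptr (- (q k *: w + v)) hS.
pose y' := c - q k *: (y + w) - v.
have uE : y' + (q k *: w + v) = c + z0.
  by rewrite /y' scalerDr qy; apply/rowP => i; rewrite !mxE; ring.
split.
  split => //; exists y' => //; rewrite ptrE opprK tr_add uE.
  apply/transfer; last by rewrite addrK.
  by rewrite -uE addrK; apply: le_trans (ltW cv) _; rewrite lerDl.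
move=> /= [[y2 y2d]]; rewrite !ptrE !opprK !tr_add addrA => Sy2 _; apply: ncx.
(* A tile within [delta] of q^k x in the moved tiling would sit at [c2] in [Tl]. As [c2] and c + q^k
   x differ by a lattice vector shorter than 2 delta, they would be equal, against [ncx]. *)
pose c2 := y2 + q k *: x + (q k *: w + v) - z0.
have Tc2 : pos c2.
  apply: (transfer _ _).1 => //; rewrite addrK; apply: le_trans (ler_normD _ _) _.
  by rewrite qx lerD2r ltW.
suff -> : c + q k *: x = c2 by [].
have [|z2 z2E] := diffB1 (v := c2 - c); first by exists c, c2.
have dE : y2 - y' = intmx (z2 - (n ^ k)%:R *: zx) *m B1.
  rewrite map_mxB mulmxBl -z2E.
  have -> : intmx ((n ^ k)%:R *: zx) = q k *: intmx zx :> 'rV[R]_d.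
    by apply/rowP => i; rewrite !mxE intrM natz -natrX.
  rewrite -scalemxAl -xE /c2 /y' scalerDr qy; apply/rowP => i; rewrite !mxE; ring.
have : y2 - y' = 0.
  rewrite dE (disc (z2 - (n ^ k)%:R *: zx)) ?map_mx0 ?mul0mx // -dE.
  by apply: le_lt_trans (ler_normB _ _) _; rewrite ltrD.
move=> /subr0_eq y2E; rewrite /c2 y2E /y' scalerDr qy.
by apply/rowP => i; rewrite !mxE; ring.
Qed.

(** Without a coincidence the hull, of probability 1, would be covered by |W| sets of probability
    below 1 / (|W| + 1). *)
Lemma pure_coincidence (mu : probability hs R) (x m : vec) (r : R) :
  pure_discrete_spectrum mu -> (forall a, eigenvalue mu a -> phase_null a x) ->
  (exists z : 'rV[int]_d, x = intmx z *m B1) -> 0 < r -> exists k, coincidence k x m r.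
Proof.
move=> pure null xE r0; have inv := pure.1.
have [delta delta0 disc] := int_lattice_discrete B1u.
have d2 : 0 < delta / 2 by rewrite divr_gt0.
have disc2 (z : 'rV[int]_d) : `|intmx z *m B1| < delta / 2 + delta / 2 -> z = 0.
  by have -> : delta / 2 + delta / 2 = delta by [field]; exact: disc.
have [W [k1 WP]] := no_coincidence_cover m r0 d2 xE disc2.
set A := near_origin (delta / 2) in WP.
have mA : measurable A := near_origin_measurable (delta / 2).
have sW : 0 < (size W)%:R + 1 :> R by rewrite ltr_wpDl.
have ei : 0 < ((size W)%:R + 1)^-1 :> R by rewrite invr_gt0.
have [k0 k0P] := phase_null_almost_period inv pure mA null ei.
exists (maxn k0 k1); apply: contrapT => nco.
have := k0P _ (leq_maxl k0 k1); set k := maxn k0 k1 in nco *.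
set B := A `\` _ => Blt.
have mB : measurable B by apply: measurableD => //; exact: (back_measurable (q k *: x) mA).
have := pr_cover (mu := mu) (W := W) (c := ((size W)%:R + 1)^-1) (@hull_measurable _ _ _ Tl)
  (fun w => back_measurable (q k *: w.1 + w.2) mB).
rewrite pr_hull // => cov.
have : 1 <= (size W)%:R * ((size W)%:R + 1)^-1 :> R.
  apply: cov => [w|S hS]; first by rewrite pr_back // ltW.
  exact: (WP k (leq_maxr _ _) nco S hS).
by rewrite ler_pdivlMr // mul1r gerDl ler10.
Qed.

End Coincidence.

(** * Merging the tiles of Tl + L by coincidences *)

Section Merging.
Variable L : set vec.
Hypotheses (L0 : L 0) (LB : forall x y, L x -> L y -> L (x - y))
  (Lq : forall k x, L x -> L (q k *: x)).
Hypothesis Lco : forall x m r, L x -> 0 < r -> exists k, coincidence k x m r.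

Let LN x : L x -> L (- x). Proof. by move=> Lx; rewrite -sub0r; exact: LB. Qed.

(** The list consists of tiles of Tl + L. Invariant of the induction: a tile [T] of Tl + q^K L
    covers q^K times the current ball and belongs to the [K]-th supertile of every listed tile
    meeting that ball. A new tile meeting the ball is joined by a coincidence over a smaller ball
    inside both; the ball shrinks and [K] may grow. *)
Lemma merge_tiles (s : seq (I * vec)) :
  (forall t, t \in s -> exists2 l, L l & Tl (tr (proto t.1) (t.2 - l))) ->
  exists m r K T l, [/\ 0 < r, forall z, `|z - m| < r -> `|z| < 1,
    forall z, `|z - m| < r -> T.1 (q K *: z), L l /\ Tl (tr T (- (q K *: l))) &
    forall t, t \in s -> (exists2 z, (tr (proto t.1) t.2).1 z & `|z - m| < r) ->
      supertile K (tr (proto t.1) t.2) T].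
Proof.
elim: s => [_|t s IH sL].
  have [T TlT T0] := tile_cover 0; have [m [r [r0 mT mb]]] := tile_regular TlT T0 ltr01.
  exists m, r, 0%N, T, 0; split => //.
  - by move=> z /mb; rewrite subr0.
  - by move=> z; rewrite scale1r; exact: mT.
  - by rewrite scaler0 oppr0 tr0.
have [|m [r [K [T [l [r0 m1b mT [Ll Tll] sT]]]]]] := IH; first by move=> u us; apply: sL; rewrite inE us orbT.
set U := tr (proto t.1) t.2.
have [[z Uz zm]|nU] := pselect (exists2 z, U.1 z & `|z - m| < r); last first.
  exists m, r, K, T, l; split => // u; rewrite inE => /orP[/eqP ->|]; [by [] | exact: sT].
have [l2 Ll2 TlU] := sL t (mem_head _ _).
rewrite -tr_add -/U in TlU.
have Uz' : (tr U (- l2)).1 (z - l2) by rewrite trE opprK subrK.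
have zr : 0 < r - `|z - m| by rewrite subr_gt0.
have [y1 [r1 [r10 yU yz]]] := tile_regular TlU Uz' zr.
(* [y1] is measured in [Tl]; undoing the translation gives the centre of a ball inside [U] and
   inside the current ball. *)
pose m1 := y1 + l2.
have m1m u : `|u - m1| < r1 -> `|u - m| < r.
  move=> um; have -> : u - m = (u - l2 - (z - l2)) + (z - m).
    by apply/rowP => i; rewrite !mxE; ring.
  apply: le_lt_trans (ler_normD _ _) _; rewrite -ltrBrDr; apply: yz.
  by have -> : u - l2 - y1 = u - m1 by rewrite /m1; apply/rowP => i; rewrite !mxE; ring.
(* T - q^K l and U - l2 both belong to [Tl]; compared at level [K] their displacements differ by q^K
   (l - l2), the vector for which a coincidence is taken. *)
have Lx : L (q K *: (l - l2)) by apply: Lq; exact: LB.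
have qr : 0 < q K * r1 by rewrite mulr_gt0 // q_gt0.
have [k [c [Tc Tcx cin]]] := Lco (q K *: (m1 - l)) Lx qr.
have qkK : q (k + K) = q k * q K by rewrite exprD.
(* The two tiles of the coincidence become this same tile once the translations by [l] and [l2] are
   undone. *)
pose Ts := tr (tr (proto i0) c) (q (k + K) *: l).
have cin' u : (tr (proto i0) c).1 u -> `|u - q (k + K) *: (m1 - l)| < q (k + K) * r1.
  by move=> /cin; rewrite scalerA -qkK mulrA -qkK.
have [_ [_ [x0 x0P]]] := proto_tile i0.
have cx0 : (tr (proto i0) c).1 (x0 + c) by rewrite trE addrK.
have TTs : supertile k T Ts.
  have cb : contains_ball (tr T (- (q K *: l))) (q K *: (m1 - l)) (q K * r1).
    move=> u um; rewrite trE opprK.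
    have -> : u + q K *: l = q K *: ((q K)^-1 *: u + l) by rewrite scalerDr scale_qK.
    apply/mT/m1m; rewrite (scale_q_lt K) scalerDr scale_qK //.
    by have -> : u + q K *: l - q K *: m1 = u - q K *: (m1 - l) by
      apply/rowP => i; rewrite !mxE; ring.
  have := mem_supertile Tll Tc cb cx0 (cin _ cx0).
  move=> /(supertile_tr (q K *: l)); rewrite tr_add addNr tr0.
  by rewrite scalerA -qkK.
have UTs : supertile (k + K) U Ts.
  have Tcx' : Tl (tr (proto i0) (c + q (k + K) *: (l - l2))) by rewrite qkK -scalerA.
  have cx0' : (tr (proto i0) (c + q (k + K) *: (l - l2))).1 (x0 + (c + q (k + K) *: (l - l2))).
    by rewrite trE addrK.
  have zin : `|x0 + (c + q (k + K) *: (l - l2)) - q (k + K) *: y1| < q (k + K) * r1.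
    have -> : x0 + (c + q (k + K) *: (l - l2)) - q (k + K) *: y1 =
        x0 + c - q (k + K) *: (m1 - l).
      by rewrite /m1; apply/rowP => i; rewrite !mxE; ring.
    exact: cin'.
  have := mem_supertile TlU Tcx' yU cx0' zin.
  move=> /(supertile_tr l2); rewrite tr_add addNr tr0 tr_add /Ts tr_add.
  by have -> : c + q (k + K) *: (l - l2) + q (k + K) *: l2 = c + q (k + K) *: l by
    apply/rowP => i; rewrite !mxE; ring.
have [y2 [r2 [r20 yc _]]] := tile_regular Tc cx0 ltr01.
(* Centre of a ball whose inflation by q^(k + K) lies in [Ts]. *)
pose m2 := (q (k + K))^-1 *: (y2 + q (k + K) *: l).
have qkK0 : 0 < q (k + K) by exact: q_gt0.
have m2c u : `|u - m2| < r2 / q (k + K) -> (tr (proto i0) c).1 (q (k + K) *: (u - l)).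
  rewrite (scale_q_lt (k + K)) /m2 scale_qK // [_ * (_ / _)]mulrC divfK ?gt_eqF // => um.
  apply: yc; rewrite scalerBr.
  by have -> : q (k + K) *: u - q (k + K) *: l - y2 = q (k + K) *: u - (y2 + q (k + K) *: l) by
    apply/rowP => i; rewrite !mxE; ring.
have m2m u : `|u - m2| < r2 / q (k + K) -> `|u - m| < r.
  move=> /m2c/cin'; rewrite -scale_q_lt // => um; apply: m1m.
  by have -> : u - m1 = u - l - (m1 - l) by apply/rowP => i; rewrite !mxE; ring.
exists m2, (r2 / q (k + K)), (k + K)%N, Ts, l; split.
- by rewrite divr_gt0.
- by move=> u /m2m/m1b.
- by move=> u /m2c um; rewrite /Ts (trE (tr _ c)) -scalerBr.
- by split => //; rewrite /Ts trK.
- move=> u; rewrite inE => /orP[/eqP -> _|us [w uw wm]]; first exact: UTs.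
  by apply: (supertile_add _ TTs); apply: sT => //; exists w => //; exact: m2m.
Qed.

Hypothesis Lfin : forall j (r : R), finite_set [set x : vec | `|x| <= r /\
  exists2 l, L l & Tl (tr (proto j) (x - l))].

(** All tiles of Tl + L positioned so as possibly to meet the unit ball are merged. For [l] in [L],
    a tile [T0] of [Tl] covers m - l, so T0 + l covers [m] and is on the list; thus [T] lies in its
    [K]-th supertile, and T - q^K l in that of [T0], hence in [Tl]. *)
Lemma common_translate : exists K T, (0 < K)%N /\ forall l, L l -> Tl (tr T (q K *: l)).
Proof.
have [rho rho0 rhoP] := proto_bounded.
pose P j := [set x : vec | `|x| <= 1 + rho /\ exists2 l, L l & Tl (tr (proto j) (x - l))].
have ex j : exists s : seq vec, P j = [set` s] := (finite_seqP _).1 (Lfin j (1 + rho)).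
pose sj j := projT1 (cid (ex j)).
have sjP j x : (x \in sj j) <-> P j x by rewrite [P j](projT2 (cid (ex j))).
have [|m [r [K [T [l0 [r0 mb mT [Ll0 Tl0] sT]]]]]] := @merge_tiles [seq (j, x) | j <- enum I, x <- sj j].
  by move=> t /allpairsPdep[j [x [_ /sjP[_ ?] ->]]].
have mm : `|m - m| < r by rewrite subrr normr0.
have TL l : L l -> Tl (tr T (- (q K *: l))).
  move=> Ll; have [T0 TlT0 T0m] := tile_cover (m - l).
  have [j [y T0E]] := tile_form TlT0.
  rewrite T0E trE in T0m; rewrite T0E in TlT0.
  have ym : (tr (proto j) (y + l)).1 m by rewrite trE opprD addrA addrAC.
  have jy : (j, y + l) \in [seq (j, x) | j <- enum I, x <- sj j].
    apply/allpairsPdep; exists j, (y + l); split; rewrite ?mem_enum //.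
    apply/sjP; split; last by exists l; rewrite ?addrK.
    have -> : y + l = m - (m - l - y) by apply/rowP => i; rewrite !mxE; ring.
    apply: le_trans (ler_normB _ _) _; apply: lerD; first by apply/ltW/mb.
    exact: rhoP T0m.
  have /(supertile_tr (- l)) := sT _ jy (ex_intro2 _ _ m ym mm).
  by rewrite -tr_add trK scalerN; exact: supertile_sub.
have TlT : Tl T by have := TL 0 L0; rewrite scaler0 oppr0 tr0.
have [j [y TE]] := tile_form TlT.
(* One more substitution makes the exponent positive. *)
have [T' TT'] := supertile_nonempty 1 j y; rewrite -TE in TT'.
exists K.+1, T'; split => // l Ll.
have := TL _ (LN Ll); rewrite scalerN opprK => TlTl.
have := supertile_tr (q K *: l) TT'; rewrite scalerA -exprD.
exact: supertile_sub.
Qed.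

End Merging.

(** The [p]-th supertile of a tile of type [j] at x - l has a reference tile at b j + q^p (x - l).
    So differences of the [x] become vectors of the lattice of [B1] when multiplied by q^p, which
    keeps distinct [x] apart. *)
Lemma shifted_pos_finite (B1 : 'M[R]_d) (L : set vec) : B1 \in unitmx ->
  (forall v, pos_diff v -> exists z : 'rV[int]_d, v = intmx z *m B1) ->
  (forall l, L l -> exists z : 'rV[int]_d, l = intmx z *m B1) ->
  forall j (r : R), finite_set [set x : vec | `|x| <= r /\
    exists2 l, L l & Tl (tr (proto j) (x - l))].
Proof.
move=> B1u diffB1 LB1 j r; have [delta delta0 disc] := int_lattice_discrete B1u.
apply: (unif_discrete_finite (delta := delta / q p) (r := r)); last by move=> x [].
  by rewrite divr_gt0 // q_gt0.
move=> x x' [_ [l Ll Tx]] [_ [l' Ll' Tx']].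
rewrite (scale_q_lt p) [q p * _]mulrC divfK ?gt_eqF ?q_gt0 // => xx'.
have [|z1 z1E] := diffB1 ((b j + q p *: (x - l)) - (b j + q p *: (x' - l'))).
  exists (b j + q p *: (x' - l')), (b j + q p *: (x - l)).
  by split => //; [exact: (supertile_sub Tx' (pP j _)) | exact: (supertile_sub Tx (pP j _))].
have [z2 z2E] := LB1 _ Ll; have [z3 z3E] := LB1 _ Ll'.
have E : q p *: x - q p *: x' = intmx (z1 + (n ^ p)%:R *: (z2 - z3)) *m B1.
  have sz (z : 'rV[int]_d) : intmx ((n ^ p)%:R *: z) = q p *: intmx z :> 'rV[R]_d.
    by apply/rowP => i; rewrite !mxE intrM natz -natrX.
  rewrite map_mxD mulmxDl -z1E sz map_mxB -scalemxAl mulmxBl -z2E -z3E.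
  by apply/rowP => i; rewrite !mxE; ring.
have : q p *: x - q p *: x' = 0.
  by rewrite E (disc (z1 + (n ^ p)%:R *: (z2 - z3))) ?map_mx0 ?mul0mx // -E.
by move=> /subr0_eq/(scalerI (lt0r_neq0 (q_gt0 p))).
Qed.

End SelfAffine.

(** * The expansion factor, and the assembly of lattice and translates *)

Lemma iter_sumset_sub (R : realType) (d M : nat) (A B : set 'rV[R]_d) : A `<=` B ->
  iter M (sumset A) A `<=` iter M (sumset B) B.
Proof.
move=> AB; elim: M => [|M IH] //= x [u Au [w /IH Bw <-]]; exists u; first exact: AB.
by exists w.
Qed.

(** For d > 0 the all-ones vector is an eigenvector with eigenvalue [n]. *)
Lemma expanding_scalar (R : realType) (d n : nat) : (0 < d)%N ->
  expanding (n%:R%:M : 'M[R]_d) -> (1 < n)%N.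
Proof.
move=> d0 /(_ n%:R (const_mx 1)); rewrite normr_nat ltr1n; apply.
  apply/eqP => /rowP/(_ (Ordinal d0)); rewrite !mxE => /eqP; by rewrite oner_eq0.
rewrite (_ : map_mx _ _ = n%:R%:M) ?mul_mx_scalar //.
apply/matrixP => i j; rewrite !mxE; case: (i == j); rewrite ?mulr1n ?mulr0n //.
exact: (rmorph_nat (real_complex R) n).
Qed.

Unset Implicit Arguments.

Theorem theorem4p17 (R : realType) (d : nat) (Lab : finType) (I : finType)
  (proto : I -> tile R d Lab) (Q : 'M[R]_d) (omega : I -> seq (I * 'rV[R]_d))
  (n : nat) (Tl : set (tile R d Lab)) :
  (0 < n)%N ->
  subst_rule proto Q omega -> primitive omega -> rule_FLC proto Q omega ->
  Q = n%:R%:M ->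
  self_affine proto Q omega Tl ->
  exists (L : set 'rV[R]_d) (M : nat),
    lattice L /\ (0 < M)%N /\ L `<=` sumset_iter (return_vectors Tl) M /\
    (forall mu : probability (hull_space Tl) R,
       pure_discrete_spectrum mu ->
       exists (K : nat) (T : tile R d Lab),
         (0 < K)%N /\ Tl T /\
         forall x, L x -> Tl (tr T ((n ^ K)%:R *: x))).
Proof.
move=> _ rule prim _ QE Tlsa; rewrite {}QE in rule Tlsa.
have [d0|d0] := posnP d.
  subst d; have v0 (x y : 'rV[R]_0) : x = y by apply/rowP => -[].
  have [T TlT _] := tile_cover Tlsa 0.
  exists [set intmx z *m 1%:M | z in [set: 'rV[int]_0]], 1%N; split.
    by exists 1%:M; rewrite unitmx1.
  split => //; split => [x _|mu _].
    by exists T; rewrite (v0 x 0) tr0.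
  by exists 1%N, T; split => //; split => // x _; rewrite (v0 (_ *: x) 0) tr0.
have n1 : (1 < n)%N by exact: expanding_scalar d0 rule.2.2.1.
have [p [i0 [b [p0 pP]]]] := primitive_supertile rule prim Tlsa.
have [B1 [B2 [M [B1u B2u diffB1 B21 sumB2]]]] := return_lattice n1 rule Tlsa p0 pP.
pose L := [set intmx z *m B2 | z in [set: 'rV[int]_d]].
have LB1 l : L l -> exists z : 'rV[int]_d, l = intmx z *m B1 by move=> [z _ <-]; exact: B21.
have L0 : L 0 by exists 0; rewrite // map_mx0 mul0mx.
have LB x y : L x -> L y -> L (x - y).
  by move=> [z _ <-] [z' _ <-]; exists (z - z'); rewrite // map_mxB mulmxBl.
have Lq k x : L x -> L (n%:R ^+ k *: x).
  move=> [z _ <-]; exists ((n ^ k)%:R *: z) => //; rewrite scalemxAl; congr (_ *m _).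
  by apply/rowP => i; rewrite !mxE intrM natz -natrX.
(* [sumset_iter] at [M.+1] unfolds to [iter M], a sum of M + 1 sets. *)
exists L, M.+1; split; first by exists B2.
split => //; split => [_ [z _ <-]|mu pure].
  by apply: iter_sumset_sub (sumB2 z); exact: pos_diff_return.
have Lco x m r : L x -> 0 < r -> exists k, coincidence proto n Tl i0 k x m r.
  (* Vectors of [L] are sums of differences, so their phases tend to 1 for every eigenvalue. *)
  move=> Lx r0; apply: (pure_coincidence n1 rule Tlsa pP B1u diffB1 m pure _ (LB1 _ Lx) r0).
  move=> a ea; case: Lx => z _ <-.
  exact: (eigenvalue_phase_null_sum n1 rule Tlsa pure.1 ea (sumB2 z)).
have Lfin := shifted_pos_finite n1 Tlsa pP B1u diffB1 LB1.
have [K [T [K0 TL]]] := common_translate n1 rule Tlsa L0 LB Lq Lco Lfin.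
exists K, T; split => //; split; first by have := TL 0 L0; rewrite scaler0 tr0.
by move=> x Lx; rewrite natrX; exact: TL.
Qed.
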